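(* Let $\tfrac12<\theta<1$ and let $A^\psi_a$ be the localization operator with standard Gaussian window $\psi$ and symbol $a\in L^\infty_{\mathrm{loc}}(\mathbb{R}^{2d})$ such that for every $\varepsilon>0$ there exists $C_\varepsilon>0$ with $$|a(x,\xi)|\le C_\varepsilon e^{\varepsilon(|x|^{1/\theta}+|\xi|^{1/\theta})}.$$ Then for every $u\in\mathcal{S}'_\theta(\mathbb{R}^d)$ we have $\mathrm{WF}^\theta_{\mathrm{gl}}(A^\psi_a u)\subset\mathrm{WF}^\theta_{\mathrm{gl}}(u)$.
   Context: $\mathcal{S}_\theta(\mathbb{R}^d)$ is the union over $C>0$ of the Banach spaces of all $f\in C^\infty(\mathbb{R}^d)$ with $\sup_{\alpha,\beta\in\mathbb{N}^d}\sup_{x} C^{-|\alpha|-|\beta|}(\alpha!\,\beta!)^{-\theta}|x^\alpha\partial^\beta f(x)|<\infty$, with the inductive limit topology. $\mathcal{S}_\theta'(\mathbb{R}^d)$ is its topological dual; $\langle\cdot,\cdot\rangle$ is the bilinear duality pairing. Standard Gaussian window: $\psi(y)=\pi^{-d/4}e^{-|y|^2/2}$; short time Fourier transform: $V_\psi u(x,\xi)=(2\pi)^{-d/2}\langle u,\psi(\cdot-x)e^{-i\langle\xi,\cdot\rangle}\rangle$. Localization operator: $A^\psi_a$ is weakly defined by $(A^\psi_a u,v)=\int_{\mathbb{R}^{2d}}a(x,\xi)\,V_\psi u(x,\xi)\,\overline{V_\psi v(x,\xi)}\,dx\,d\xi$ for $v\in\mathcal{S}_\theta(\mathbb{R}^d)$,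 where $(w,v)=\langle w,\overline v\rangle$; that is, $A^\psi_a u=V_\psi^*(a\cdot V_\psi u)$. For $a$ as in the claim it is known to be continuous on $\mathcal{S}_\theta(\mathbb{R}^d)$ and on $\mathcal{S}'_\theta(\mathbb{R}^d)$. Global wave front set: a subset of $\mathbb{R}^{2d}\setminus\{0\}$ is conic if invariant under multiplication by positive reals. For $u\in\mathcal{S}_\theta'(\mathbb{R}^d)$, a point $(x_0,\xi_0)\in\mathbb{R}^{2d}\setminus\{0\}$ is not in $\mathrm{WF}^\theta_{\mathrm{gl}}(u)$ iff there are an open conic neighbourhood $\Gamma'$ of $(x_0,\xi_0)$ and $C,\varepsilon>0$ with $|V_\psi u(x,\xi)|\le C e^{-\varepsilon(|x|^{1/\theta}+|\xi|^{1/\theta})}$ for all $(x,\xi)\in\Gamma'$. *)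

(* Defs.v *)
From HB Require Import structures.
From mathcomp Require Import all_boot all_order all_algebra.
From mathcomp Require Import complex.
From mathcomp Require Import all_classical all_reals all_analysis.

Set Implicit Arguments.
Unset Strict Implicit.
Unset Printing Implicit Defensive.
Import Order.TTheory GRing.Theory Num.Theory.
Import numFieldNormedType.Exports.

Export ComplexField.Normc(normc).

Local Open Scope classical_set_scope.
Local Open Scope ring_scope.
Local Open Scope complex_scope.

(* The sigma-algebra on 'rV[R]_n is the product of the Borel sigma-algebras of
   the n coordinates, i.e. the Borel sigma-algebra of R^n. *)
Definition rV_display : measure_display. Proof. by constructor. Qed.

Section measurable_rV.
Context {R : realType} (n : nat).

Let coors (i : 'I_n) (x : 'rV[R]_n) : measurableTypeR R := x 0 i.

Let rV_set0 : g_sigma_preimage coors set0.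
Proof. exact: sigma_algebra0. Qed.

Let rV_setC A : g_sigma_preimage coors A -> g_sigma_preimage coors (~` A).
Proof. exact: sigma_algebraC. Qed.

Let rV_bigcup (F : (set 'rV[R]_n)^nat) :
  (forall i, g_sigma_preimage coors (F i)) ->
  g_sigma_preimage coors (\bigcup_i (F i)).
Proof. exact: sigma_algebra_bigcup. Qed.

HB.instance Definition _ := @isMeasurable.Build rV_display
  'rV[R]_n (g_sigma_preimage coors) rV_set0 rV_setC rV_bigcup.

Lemma measurable_coord (i : 'I_n) :
  measurable_fun setT (fun x : 'rV[R]_n => x 0 i : measurableTypeR R).
Proof.
move=> _ Y mY; rewrite setTI; apply: sub_sigma_algebra => /=.
rewrite -bigcup_seq/=; exists i => /=; first by rewrite mem_index_enum.
by exists Y => //; rewrite setTI.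
Qed.

Lemma measurable_fun_rV d' (T : measurableType d') (f : T -> 'rV[R]_n) :
  (forall i, measurable_fun setT (fun t => f t 0 i : measurableTypeR R)) ->
  measurable_fun setT f.
Proof.
move=> mf; apply: (@measurability _ _ _ _ setT f
  (\big[setU/set0]_(i < n) preimage_set_system setT (coors i) measurable)) => //.
move=> _ [B +] <-; rewrite -bigcup_seq => -[i _ [A mA <-]].
rewrite setTI; have := mf i measurableT A mA.
by rewrite !setTI; apply.
Qed.

End measurable_rV.

Section lebesgue_rV.
Context {R : realType}.

Definition cons_rV n (p : measurableTypeR R * 'rV[R]_n) : 'rV[R]_n.+1 :=
  \row_i (if unlift ord0 i is Some j then p.2 0 j else p.1).

Definition uncons_rV n (x : 'rV[R]_n.+1) : measurableTypeR R * 'rV[R]_n :=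
  (x 0 0, \row_j x 0 (lift ord0 j)).

Lemma cons_rVK n : cancel (@cons_rV n) (@uncons_rV n).
Proof.
move=> [r x]; congr (_, _); first by rewrite mxE unlift_none.
by apply/rowP => j; rewrite !mxE liftK.
Qed.

Lemma measurable_cons_rV n : measurable_fun setT (@cons_rV n).
Proof.
apply: measurable_fun_rV => i; rewrite /cons_rV.
case: (unliftP ord0 i) => [j|] ->; under eq_fun do rewrite mxE.
- under eq_fun do rewrite liftK.
  exact: (measurableT_comp (measurable_coord j) measurable_snd).
- under eq_fun do rewrite unlift_none.
  exact: measurable_fst.
Qed.

Lemma measurable_uncons_rV n : measurable_fun setT (@uncons_rV n).
Proof.
apply: measurable_fun_pair; first exact: measurable_coord.
apply: measurable_fun_rV => j; under eq_fun do rewrite mxE.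
exact: measurable_coord.
Qed.

Section cons_measure.
Local Open Scope ereal_scope.
Context n (m : {sigma_finite_measure set 'rV[R]_n -> \bar R}).

Local Notation prod_measure := (@lebesgue_measure R \x m).

Definition cons_measure := pushforward prod_measure (@cons_rV n).

Let cons_measure0 : cons_measure set0 = 0.
Proof. by rewrite /cons_measure /pushforward preimage_set0 measure0. Qed.

Let cons_measure_ge0 A : 0 <= cons_measure A.
Proof. exact: (@measure_ge0 _ _ _ prod_measure). Qed.

Let cons_measure_sigma_additive : semi_sigma_additive cons_measure.
Proof.
move=> F mF tF mUF; rewrite /cons_measure /pushforward preimage_bigcup.
have mC := @measurable_cons_rV n; apply: measure_semi_sigma_additive.
- by move=> k; rewrite -[X in measurable X]setTI; exact: mC.
- apply/trivIsetP => /= i j _ _ ij; rewrite -preimage_setI.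
  by move/trivIsetP : tF => /(_ _ _ _ _ ij) ->//; rewrite preimage_set0.
- by rewrite -preimage_bigcup -[X in measurable X]setTI; exact: mC.
Qed.

HB.instance Definition _ := isMeasure.Build _ _ _ cons_measure
  cons_measure0 cons_measure_ge0 cons_measure_sigma_additive.

Let cons_measure_sigma_finite : sigma_finite setT cons_measure.
Proof.
have /sigma_finiteP[F [FT ndF Foo]] := sigma_finiteT (@lebesgue_measure R).
have /sigma_finiteP[G [GT ndG Goo]] := sigma_finiteT m.
exists (fun k => @uncons_rV n @^-1` (F k `*` G k)).
  rewrite -preimage_bigcup (_ : \bigcup_k _ = setT) ?preimage_setT//.
  rewrite -subTset => -[x y] _.
  have [i _ Fix] : (\bigcup_k F k) x by rewrite -FT.
  have [j _ Gjy] : (\bigcup_k G k) y by rewrite -GT.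
  exists (maxn i j) => //; split.
    by move: x Fix; exact/subsetPset/ndF/leq_maxl.
  by move: y Gjy; exact/subsetPset/ndG/leq_maxr.
move=> k; have [mF Fk] := Foo k; have [mG Gk] := Goo k; split.
  rewrite -[X in measurable X]setTI.
  by apply: measurable_uncons_rV => //; exact: measurableX.
rewrite /cons_measure /pushforward -comp_preimage.
rewrite (_ : _ \o _ = id) ?preimage_id; last exact/funext/cons_rVK.
by rewrite product_measure1E// lte_mul_pinfty// ge0_fin_numE.
Qed.

HB.instance Definition _ := Measure_isSigmaFinite.Build _ _ _ cons_measure
  cons_measure_sigma_finite.

End cons_measure.

Fixpoint lebesgue_rV n : {sigma_finite_measure set 'rV[R]_n -> \bar R} :=
  match n with
  | 0 => \d_(0 : 'rV[R]_0)
  | n'.+1 => cons_measure (lebesgue_rV n')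
  end.

End lebesgue_rV.

Section gelfand_shilov.
Context {R : realType} (d : nat).

Definition lebesgue_phase : {measure set ('rV[R]_d * 'rV[R]_d) -> \bar R} :=
  (lebesgue_rV d \x lebesgue_rV d)%E.

Definition cintegral d' (T : measurableType d')
    (mu : {measure set T -> \bar R}) (f : T -> R[i]) : R[i] :=
  (\int[mu]_x complex.Re (f x)) +i* (\int[mu]_x complex.Im (f x)).

Definition dotp (x y : 'rV[R]_d) : R := \sum_(i < d) x 0 i * y 0 i.

(* The library norm on 'rV[R]_d is the sup norm. *)
Definition enorm (x : 'rV[R]_d) : R := Num.sqrt (dotp x x).

Definition cis (t : R) : R[i] := cos t +i* sin t.

Definition multi_index := {ffun 'I_d -> nat}.

Definition mi_abs (alpha : multi_index) : nat := (\sum_(i < d) alpha i)%N.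

Definition mi_fact (alpha : multi_index) : nat := (\prod_(i < d) (alpha i)`!)%N.

Definition monomial (alpha : multi_index) (x : 'rV[R]_d) : R :=
  \prod_(i < d) x 0 i ^+ alpha i.

Definition partial (i : 'I_d) (g : 'rV[R]_d -> R) : 'rV[R]_d -> R :=
  'D_(delta_mx 0 i) g.

Definition partials (g : 'rV[R]_d -> R) (s : seq 'I_d) : 'rV[R]_d -> R :=
  foldr partial g s.

Definition real_smooth (g : 'rV[R]_d -> R) : Prop :=
  forall s : seq 'I_d, continuous (partials g s) /\
    forall i x, derivable (partials g s) x (delta_mx 0 i).

Definition smooth (f : 'rV[R]_d -> R[i]) : Prop :=
  real_smooth (fun x => complex.Re (f x)) /\ real_smooth (fun x => complex.Im (f x)).

Definition mi_seq (beta : multi_index) : seq 'I_d :=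
  flatten [seq nseq (beta i) i | i <- enum 'I_d].

Definition mi_partial (beta : multi_index) (f : 'rV[R]_d -> R[i])
    (x : 'rV[R]_d) : R[i] :=
  partials (fun y => complex.Re (f y)) (mi_seq beta) x +i*
  partials (fun y => complex.Im (f y)) (mi_seq beta) x.

Definition gs_norm (theta C : R) (f : 'rV[R]_d -> R[i]) : \bar R :=
  ereal_sup [set r | exists (alpha beta : multi_index) (x : 'rV[R]_d),
    r = (C ^- (mi_abs alpha + mi_abs beta)%N *
         (mi_fact alpha * mi_fact beta)%N%:R `^ (- theta) *
         normc ((monomial alpha x)%:C * mi_partial beta f x))%:E].

Definition gs_step (theta C : R) : set ('rV[R]_d -> R[i]) :=
  [set f | smooth f /\ (gs_norm theta C f < +oo)%E].

Definition gs_space (theta : R) : set ('rV[R]_d -> R[i]) :=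
  \bigcup_(C in [set C : R | 0 < C]) gs_step theta C.

Definition absolutely_convex (V : set ('rV[R]_d -> R[i])) : Prop :=
  forall f g (a b : R[i]), V f -> V g -> normc a + normc b <= 1 ->
    V (fun x => a * f x + b * g x).

(* Neighbourhoods in the locally convex inductive limit: the absolutely convex
   sets whose trace on every step is a neighbourhood of 0 for the step norm
   form a basis of neighbourhoods of 0. *)
Definition gs_nbhs0 (theta : R) (U : set ('rV[R]_d -> R[i])) : Prop :=
  exists V : set ('rV[R]_d -> R[i]),
    [/\ V `<=` gs_space theta, absolutely_convex V,
        forall C, 0 < C -> exists2 r : R, 0 < r &
          forall h, gs_step theta C h -> (gs_norm theta C h < r%:E)%E -> V h
      & V `<=` U].

Definition gs_nbhs (theta : R) (f : 'rV[R]_d -> R[i])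
    (U : set ('rV[R]_d -> R[i])) : Prop :=
  gs_nbhs0 theta [set h | U (fun x => f x + h x)].

Definition functional := ('rV[R]_d -> R[i]) -> R[i].

(* Functionals are total functions; only their values on gs_space theta are
   relevant, and u phi is the bilinear pairing <u, phi>. *)
Definition gs_dual (theta : R) : set functional :=
  [set u | (forall f g (c : R[i]), gs_space theta f -> gs_space theta g ->
              u (fun x => c * f x + g x) = c * u f + u g) /\
           (forall f, gs_space theta f -> forall e : R, 0 < e ->
              gs_nbhs theta f [set g | normc (u g - u f) < e])].

Definition regular_functional (v : 'rV[R]_d -> R[i]) : functional :=
  fun phi => cintegral (lebesgue_rV d) (fun y => v y * phi y).

Definition gauss_window (y : 'rV[R]_d) : R :=
  pi `^ (- (d%:R / 4)) * expR (- (enorm y ^+ 2 / 2)).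

Definition stft (u : functional) (z : 'rV[R]_d * 'rV[R]_d) : R[i] :=
  ((2 * pi) `^ (- (d%:R / 2)))%:C *
  u (fun y => (gauss_window (y - z.1))%:C * cis (- dotp z.2 y)).

(* The weak definition of A u prescribes (A u, v) = <A u, conj v>; the value at
   a test function phi is obtained with v = conj phi. *)
Definition localization_op (a : 'rV[R]_d * 'rV[R]_d -> R[i]) (u : functional) :
    functional :=
  fun phi => cintegral lebesgue_phase (fun z =>
    a z * stft u z *
    conjc (stft (regular_functional (fun y => conjc (phi y))) z)).

(* Lebesgue measurability, as almost everywhere equality with a Borel
   function. *)
Definition lebesgue_measurable_fun (a : 'rV[R]_d * 'rV[R]_d -> R[i]) : Prop :=
  exists b : 'rV[R]_d * 'rV[R]_d -> R[i],
    [/\ measurable_fun setT (fun z => complex.Re (b z)),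
        measurable_fun setT (fun z => complex.Im (b z))
      & {ae lebesgue_phase, forall z, a z = b z}].

Definition Linfty_loc (a : 'rV[R]_d * 'rV[R]_d -> R[i]) : Prop :=
  lebesgue_measurable_fun a /\
  forall K : set ('rV[R]_d * 'rV[R]_d), compact K ->
    exists M : R, {ae lebesgue_phase, forall z, K z -> normc (a z) <= M}.

Definition phase_weight (theta : R) (z : 'rV[R]_d * 'rV[R]_d) : R :=
  enorm z.1 `^ theta^-1 + enorm z.2 `^ theta^-1.

Definition conic (Gamma : set ('rV[R]_d * 'rV[R]_d)) : Prop :=
  Gamma `<=` [set z | z != 0] /\
  forall (t : R) z, 0 < t -> Gamma z -> Gamma (t *: z).

Definition gs_wavefront (theta : R) (u : functional) :
    set ('rV[R]_d * 'rV[R]_d) :=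
  [set z0 | z0 != 0 /\
    ~ exists Gamma : set ('rV[R]_d * 'rV[R]_d),
        [/\ open Gamma, conic Gamma, Gamma z0 &
          exists C e : R, [/\ 0 < C, 0 < e & forall z, Gamma z ->
            normc (stft u z) <= C * expR (- e * phase_weight theta z)]]].

End gelfand_shilov.

(* Main.v *)
Require Import Defs.
From mathcomp Require Import all_boot all_order all_algebra.
From mathcomp Require Import complex ring lra.
From mathcomp Require Import all_classical all_reals all_analysis.
From mathcomp Require Import measurable_realfun.

Import Order.TTheory GRing.Theory Num.Theory.
Import numFieldNormedType.Exports.

(* Write phi_z for the time-frequency shift of the Gaussian window by z, Q(z) for
   |x|^2 + |xi|^2 and w(z) for |x|^(1/theta) + |xi|^(1/theta).  The STFT of A u at z1
   is the integral of a(z) V u(z) against the conjugate of V(conj phi_z1)(z), whose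
   modulus is a constant times exp (- Q(z1 - z) / 4).
   Let Gamma be a cone on which V u is O(exp (- e w)).
   On Gamma, the quasi-triangle inequality
   w(z1) <= 4 (w(z) + w(z1 - z)) and w <= 2 + Q (because 1 < 1/theta < 2) trade the
   decay in z for a decay in z1 at the price of half of the Gaussian.
   Off Gamma, a and V u are at most O(exp (eta Q(z))) for every eta > 0, and when
   z1 lies in a smaller cone both Q(z) and Q(z1) are O(Q(z1 - z)), so the Gaussian
   absorbs the growth.  What remains of the Gaussian has an integral that does not
   depend on z1.
   The growth of V u follows from the continuity of u on one step of the inductive
   limit: since theta >= 1/2, Hermite function estimates bound the norm of phi_z
   in the step of a large enough radius by a multiple of exp (eta Q(z)). *)

Set Implicit Arguments.
Unset Strict Implicit.
Unset Printing Implicit Defensive.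

Local Open Scope classical_set_scope.
Local Open Scope ring_scope.
Local Open Scope complex_scope.

(** * The Fourier transform of a Gaussian *)

Section is_derive_fun.
Context {R : realType}.
Implicit Types (f g : R -> R) (t a b : R).

Lemma is_derive_addf f g t a b : is_derive t 1 f a -> is_derive t 1 g b ->
  is_derive t 1 (fun s => f s + g s) (a + b).
Proof. by move=> df dg; have := is_deriveD df dg. Qed.

Lemma is_derive_subf f g t a b : is_derive t 1 f a -> is_derive t 1 g b ->
  is_derive t 1 (fun s => f s - g s) (a - b).
Proof. by move=> df dg; have := is_deriveB df dg. Qed.

Lemma is_derive_mulf f g t a b : is_derive t 1 f a -> is_derive t 1 g b ->
  is_derive t 1 (fun s => f s * g s) (a * g t + f t * b).
Proof.
move=> df dg; have := is_deriveM df dg.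
by move=> /is_derive_eq; apply; rewrite addrC mulrC.
Qed.

Lemma is_derive_affine (k c t : R) : is_derive t 1 (fun s : R => k * s + c) k.
Proof.
rewrite -[k in X in is_derive _ _ _ X]addr0; apply: is_derive_addf.
have := is_deriveZ k (is_derive_id t (1 : R)).
by move=> /is_derive_eq; apply; rewrite /GRing.scale/= mulr1.
Qed.

Lemma is_derive_expR_comp f t a : is_derive t 1 f a ->
  is_derive t 1 (fun s => expR (f s)) (a * expR (f t)).
Proof.
move=> df; rewrite mulrC.
exact: (is_derive1_comp (is_derive_expR (f t)) df).
Qed.

Lemma is_derive_cos_comp f t a : is_derive t 1 f a ->
  is_derive t 1 (fun s => cos (f s)) (- (a * sin (f t))).
Proof.
move=> df; rewrite mulrC -mulNr.
exact: (is_derive1_comp (is_derive_cos (f t)) df).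
Qed.

Lemma is_derive_sin_comp f t a : is_derive t 1 f a ->
  is_derive t 1 (fun s => sin (f s)) (a * cos (f t)).
Proof.
move=> df; rewrite mulrC.
exact: (is_derive1_comp (is_derive_sin (f t)) df).
Qed.

Lemma is_derive_continuous f (df : R -> R) :
  (forall t, is_derive t 1 f (df t)) -> continuous f.
Proof.
by move=> fdf t; apply/differentiable_continuous/derivable1_diffP.
Qed.

End is_derive_fun.

Lemma continuous_compf {R : realType} {T : topologicalType} (f : T -> R)
    (g : R -> R) :
  continuous f -> continuous g -> continuous (fun t => g (f t)).
Proof. by move=> cf cg t; exact: (continuous_comp (cf t) (cg (f t))). Qed.

Lemma continuous_mulf {R : realType} {T : topologicalType} (f g : T -> R) :
  continuous f -> continuous g -> continuous (fun t => f t * g t).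
Proof. by move=> cf cg t; exact: cvgM (cf t) (cg t). Qed.

Lemma continuous_addf {R : realType} {T : topologicalType} (f g : T -> R) :
  continuous f -> continuous g -> continuous (fun t => f t + g t).
Proof. by move=> cf cg t; exact: cvgD (cf t) (cg t). Qed.

Lemma norm_le_expR_sqr {R : realType} (t : R) : `|t| <= expR (t ^+ 2 / 2).
Proof.
apply: (le_trans _ (expR_ge1Dx _)).
have := sqr_ge0 (`|t| - 1); rewrite sqrrB real_normK ?num_real//; lra.
Qed.

Lemma integrable_dominated {R : realType} (f g : R -> R) : continuous f ->
  (@lebesgue_measure R).-integrable setT (EFin \o g) -> (forall t, `|f t| <= g t) ->
  (@lebesgue_measure R).-integrable setT (EFin \o f).
Proof.
move=> cf ig fg; apply: (le_integrable _ _ _ ig) => //.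
  by apply/measurable_EFinP; exact: continuous_measurable_fun.
by move=> t _; rewrite lee_fin (le_trans (fg t))// ler_norm.
Qed.

(** The fundamental theorem of calculus on the intervals [I n], whose boundary terms tend to 0, and
    dominated convergence with majorant [|f|]. This supplies the integration by parts in
    [fourier_ode]. *)
Lemma Rintegral_derivative0 {R : realType} (F f : R -> R) (m : R) :
  (forall t : R, is_derive t 1 F (f t)) -> continuous f ->
  (@lebesgue_measure R).-integrable setT (EFin \o f) ->
  F (m + n.+1%:R) @[n --> \oo] --> (0 : R) ->
  F (m - n.+1%:R) @[n --> \oo] --> (0 : R) ->
  \int[@lebesgue_measure R]_t f t = 0.
Proof.
set mu := @lebesgue_measure R => dF cf intf F1 F2.
(* The radius is n + 1 so that the interval is nondegenerate for n = 0 as well. *)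
pose I n := `[m - n.+1%:R, m + n.+1%:R]%classic.
have ftc n : (\int[mu]_(t in I n) (f t)%:E =
    (F (m + n.+1%:R) - F (m - n.+1%:R))%:E)%E.
  rewrite EFinB; have cF := is_derive_continuous dF.
  apply: continuous_FTC2.
  - by rewrite ltrD2l gtrN// ltr0n.
  - exact: continuous_subspaceT.
  - split.
    + by move=> t _; have /@ex_derive := dF t.
    + exact/cvg_at_right_filter/cF.
    + exact/cvg_at_left_filter/cF.
  - by move=> t _; rewrite derive1E; have /@derive_val := dF t.
have lim0 : (\int[mu]_(t in I n) (f t)%:E @[n --> \oo] --> 0)%E.
  under eq_fun do rewrite ftc.
  apply: cvg_EFin; first exact: nearW.
  by rewrite -[X in _ --> X]subr0; exact: cvgB.
suff limf : (\int[mu]_(t in I n) (f t)%:E @[n --> \oo] -->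
    \int[mu]_t (f t)%:E)%E.
  by rewrite /Rintegral (cvg_unique _ limf lim0).
under eq_fun do rewrite integral_mkcond.
have mI n : measurable (I n) by exact: measurable_itv.
apply: (@dominated_cvg _ _ _ mu _ measurableT _ _ (fun t => `|f t|%:E)) => //=.
- move=> n; apply/(measurable_restrictT _ (mI n)).
  by apply/measurable_funTS; exact: measurable_int intf.
(* At a fixed [t] the truncated integrand is constant in n as soon as n exceeds [|t - m|]. *)
- move=> t _; apply: cvg_near_cst.
  exists (Num.truncn `|t - m|) => // n /= tn; apply: patchT.
  rewrite inE /I/= in_itv/= -ler_distl.
  rewrite (le_trans (ltW (truncnS_gt _)))// ler_nat ltnS//.
- exact: integrable_abse intf.
- move=> n t _; rewrite /patch; case: ifPn => // _.
  by rewrite abse0 lee_fin.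
Qed.

Section gauss_fourier.
Context {R : realType}.
Variable m : R.
Notation mu := (@lebesgue_measure R).

(** The variance is 1/2: up to a factor, the product of two windows of variance 1 is this function
    centred at the midpoint of their centres. *)
Definition gauss (t : R) : R := expR (- (t - m) ^+ 2).

Lemma gauss_normal_fun t : gauss t = normal_fun m (Num.sqrt 2^-1) t.
Proof.
rewrite /gauss /normal_fun sqr_sqrtr ?invr_ge0// -(mulr_natr (2^-1)).
by rewrite mulVf ?pnatr_eq0// divr1.
Qed.

Lemma gauss_normal_pdf t :
  gauss t = Num.sqrt pi * normal_pdf m (Num.sqrt 2^-1) t.
Proof.
have s0 : Num.sqrt 2^-1 != 0 :> R by rewrite gt_eqF// sqrtr_gt0 invr_gt0.
rewrite normal_pdfE// gauss_normal_fun /normal_peak sqr_sqrtr ?invr_ge0//.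
rewrite -mulrnAl -(mulr_natr (2^-1)) mulVf ?pnatr_eq0// mul1r mulrA mulfV ?mul1r//.
by rewrite gt_eqF// sqrtr_gt0 pi_gt0.
Qed.

Lemma integrable_gauss : mu.-integrable setT (EFin \o gauss).
Proof.
rewrite (_ : EFin \o gauss = fun t => (Num.sqrt pi)%:E *
    (normal_pdf m (Num.sqrt 2^-1) t)%:E)%E; last first.
  by apply/funext => t; rewrite -EFinM /= gauss_normal_pdf.
by apply: integrableZl => //; exact: integrable_normal_pdf.
Qed.

Lemma Rintegral_gauss : \int[mu]_t gauss t = Num.sqrt pi.
Proof.
under eq_Rintegral do rewrite gauss_normal_pdf.
rewrite RintegralZl//; last exact: integrable_normal_pdf.
by rewrite [X in _ * X](_ : _ = 1) ?mulr1// /Rintegral integral_normal_pdf.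
Qed.

Lemma is_derive_gauss (t : R) : is_derive t 1 gauss (- (2 * (t - m)) * gauss t).
Proof.
rewrite /gauss; apply: is_derive_expR_comp.
rewrite (_ : (fun s => _) = fun s => (-1 * s + m) * (1 * s + - m)); last first.
  by apply/funext => s; ring.
have := is_derive_mulf (is_derive_affine (-1) m t) (is_derive_affine 1 (- m) t).
by move/is_derive_eq; apply; ring.
Qed.

Lemma continuous_gauss : continuous gauss.
Proof. exact: is_derive_continuous is_derive_gauss. Qed.

(** An integrable majorant, uniform in the frequency, for the frequency derivative of the Fourier
    kernel. The half of the exponent that is given up absorbs the factor [|t - m|]. *)
Definition gauss_wide (t : R) : R := expR (- ((t - m) ^+ 2 / 2)).

Lemma integrable_gauss_wide : mu.-integrable setT (EFin \o gauss_wide).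
Proof.
have p0 : normal_peak (1 : R) != 0 by rewrite gt_eqF// normal_peak_gt0// oner_eq0.
rewrite (_ : EFin \o _ = fun t => ((normal_peak 1)^-1)%:E *
    (normal_pdf m 1 t)%:E)%E; last first.
  apply/funext => t; rewrite -EFinM /= normal_pdfE ?oner_eq0// mulKf//.
  by rewrite /normal_fun/= /gauss_wide expr1n mulNr.
by apply: integrableZl => //; exact: integrable_normal_pdf.
Qed.

Lemma moment_gauss_le_wide t : `|t - m| * gauss t <= gauss_wide t.
Proof.
have -> : gauss t = expR (- ((t - m) ^+ 2 / 2)) * gauss_wide t.
  by rewrite -expRD; congr expR; lra.
rewrite mulrA ger_pMl ?expR_gt0// -ler_pdivlMr ?expR_gt0//.
by rewrite -expRN opprK mul1r; exact: norm_le_expR_sqr.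
Qed.

Section phase.
Variable phi : R.
(** The free phase lets one real kernel serve both parts of the complex integral: lowering [phi] by
    pi/2 turns the cosine into a sine. *)
Let kernel (tau t : R) := gauss t * cos (tau * (t - m) + phi).
Let kernel' (tau t : R) := - (t - m) * gauss t * sin (tau * (t - m) + phi).

Let is_derive_kernel (tau t : R) : is_derive tau 1 (kernel ^~ t) (kernel' tau t).
Proof.
have dc := is_derive_cos_comp (is_derive_affine (t - m) phi tau).
have -> : kernel ^~ t =
    fun s => cst (gauss t) s * cos ((t - m) * s + phi).
  by apply/funext => s; rewrite /kernel /= [s * _]mulrC.
have := is_derive_mulf (is_derive_cst (gauss t) tau (1 : R)) dc.
move/is_derive_eq; apply; rewrite /kernel' /cst mul0r add0r mulrN.
by rewrite [tau * _]mulrC; ring.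
Qed.

Let continuous_phase (tau : R) : continuous (fun t : R => tau * (t - m) + phi).
Proof.
rewrite (_ : (fun t : R => _) = fun t => tau * t + (phi - tau * m)).
  exact: is_derive_continuous (is_derive_affine tau _).
by apply/funext => t; ring.
Qed.

Let continuous_kernel (tau : R) : continuous (kernel tau).
Proof.
apply: continuous_mulf; first exact: continuous_gauss.
by apply: continuous_compf; [exact: continuous_phase|exact: continuous_cos].
Qed.

Let continuous_kernel' (tau : R) : continuous (kernel' tau).
Proof.
apply: continuous_mulf; last first.
  by apply: continuous_compf; [exact: continuous_phase|exact: continuous_sin].
apply: continuous_mulf; last exact: continuous_gauss.
rewrite (_ : (fun t : R => _) = fun t => (-1) * t + m).
  exact: is_derive_continuous (is_derive_affine (-1) m).
by apply/funext => t; ring.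
Qed.

Let norm_kernel tau t : `|kernel tau t| <= gauss t.
Proof.
rewrite normrM ger0_norm ?expR_ge0// ler_piMr ?expR_ge0//.
by rewrite ler_norml cos_geN1 cos_le1.
Qed.

Let norm_kernel' tau t : `|kernel' tau t| <= gauss_wide t.
Proof.
apply: (le_trans _ (moment_gauss_le_wide t)).
rewrite !normrM normrN (ger0_norm (expR_ge0 _)) ler_piMr//.
by rewrite ler_norml sin_geN1 sin_le1.
Qed.

Let integrable_kernel tau : mu.-integrable setT (EFin \o kernel tau).
Proof.
by apply: integrable_dominated (norm_kernel tau) => //; exact: integrable_gauss.
Qed.

Let integrable_kernel' tau : mu.-integrable setT (EFin \o kernel' tau).
Proof.
apply: integrable_dominated (norm_kernel' tau) => //.
exact: integrable_gauss_wide.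
Qed.

Let is_derive_fourier (tau : R) : is_derive tau 1
  (fun s => \int[mu]_t kernel s t) (\int[mu]_t kernel' tau t).
Proof.
have I : `]tau - 1, tau + 1[%classic tau by rewrite /= in_itv/=; lra.
have d1 s t : partial1of2 kernel s t = kernel' s t.
  rewrite partial1of2E; have := is_derive_kernel s t.
  by move=> /@derive_val.
have dk s t : `]tau - 1, tau + 1[%classic s -> setT t ->
    derivable (kernel ^~ t) s 1.
  by move=> _ _; have := is_derive_kernel s t => /@ex_derive.
have bk s t : `]tau - 1, tau + 1[%classic s -> setT t ->
    `|partial1of2 kernel s t| <= gauss_wide t by move=> _ _; rewrite d1.
have ik s : `]tau - 1, tau + 1[%classic s ->
    mu.-integrable setT (EFin \o kernel s) by [].
apply: DeriveDef.
  exact: (derivable_under_integral measurableT I ik dk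
    (fun=> expR_ge0 _) integrable_gauss_wide bk).
rewrite -derive1E.
rewrite (differentiation_under_integral measurableT I ik dk
    (fun=> expR_ge0 _) integrable_gauss_wide bk).
by apply: eq_Rintegral => t _; exact: d1.
Qed.

(** This primitive vanishes at both infinities, so its derivative has integral 0. That relation is
    the differential equation I' = - (tau / 2) I for the Fourier integral I. *)
Let derive_primitive (tau t : R) : is_derive t 1
  (fun s => gauss s * sin (tau * (s - m) + phi))
  (2 * kernel' tau t + tau * kernel tau t).
Proof.
have -> : (fun s => gauss s * sin (tau * (s - m) + phi)) =
    fun s => gauss s * sin (tau * s + (phi - tau * m)).
  by apply/funext => s; congr (_ * sin _); ring.
have ds := is_derive_sin_comp (is_derive_affine tau (phi - tau * m) t).
have := is_derive_mulf (is_derive_gauss t) ds.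
move/is_derive_eq; apply; rewrite /kernel /kernel'.
have -> : tau * (t - m) + phi = tau * t + (phi - tau * m) by ring.
by ring.
Qed.

(** The sign [e] treats the two ends of the line at once; there the Gaussian equals exp (- (n +
    1)^2), which is at most exp (- n). *)
Let cvg_boundary (tau e : R) : `|e| = 1 ->
  gauss (m + e * n.+1%:R) * sin (tau * (m + e * n.+1%:R - m) + phi)
    @[n --> \oo] --> (0 : R).
Proof.
move=> e1; apply: norm_cvg0.
apply: (@squeeze_cvgr _ _ _ _ (cst 0) (fun n => expR (- n%:R))).
- apply: nearW => n; rewrite /= normr_ge0/= normrM (ger0_norm (expR_ge0 _)).
  apply: (le_trans (ler_piMr (expR_ge0 _) _)).
    by rewrite ler_norml sin_geN1 sin_le1.
  rewrite ler_expR lerN2 addrAC subrr add0r exprMn -(real_normK (num_real e)).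
  rewrite e1 expr1n mul1r; apply: (@le_trans _ _ n.+1%:R); first by rewrite ler_nat.
  by rewrite expr2 ler_peMr// ler1n.
- exact: cvg_cst.
- exact: cvgn_expR.
Qed.

Let fourier_ode (tau : R) : \int[mu]_t kernel' tau t =
  - (tau / 2) * \int[mu]_t kernel tau t.
Proof.
have ik := integrableZl measurableT 2 (integrable_kernel' tau).
have ik' := integrableZl measurableT tau (integrable_kernel tau).
have c0 : continuous (fun t => 2 * kernel' tau t + tau * kernel tau t).
  apply: continuous_addf; apply: continuous_mulf => //;
  by move=> ?; exact: cvg_cst.
have := Rintegral_derivative0 (derive_primitive tau) c0.
rewrite RintegralD// !RintegralZl// => /(_ m) H.
have {H} : 2 * \int[mu]_t kernel' tau t + tau * \int[mu]_t kernel tau t = 0.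
  apply: H.
  - by have := @integrableD _ _ _ mu setT measurableT _ _ ik ik'.
  - have := cvg_boundary tau (normr1 R).
    by under eq_fun do rewrite mul1r.
  - have := @cvg_boundary tau (-1) (normrN1 R).
    by under eq_fun do rewrite mulN1r.
by move=> /eqP; rewrite addrC addr_eq0 => /eqP E; lra.
Qed.

(** By [fourier_ode] the product of the integral with exp (tau^2 / 4) has derivative 0 in the
    frequency, so it equals its value at frequency 0. *)
Lemma gauss_fourier (tau : R) :
  \int[mu]_t (gauss t * cos (tau * (t - m) + phi)) =
  Num.sqrt pi * cos phi * expR (- (tau ^+ 2 / 4)).
Proof.
pose G (s : R) := (\int[mu]_t kernel s t) * expR (s ^+ 2 / 4).
have G0 s : is_derive (s : R) 1 G 0.
  have e2 : is_derive (s : R) 1 (fun r : R => expR (r ^+ 2 / 4))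
      (s / 2 * expR (s ^+ 2 / 4)).
    apply: is_derive_expR_comp.
    have -> : (fun r : R => r ^+ 2 / 4) = fun r => (4^-1 * r + 0) * (1 * r + 0).
      by apply/funext => r; rewrite mul1r !addr0 expr2 mulrC mulrA.
    have := is_derive_mulf (is_derive_affine 4^-1 0 s) (is_derive_affine 1 0 s).
    by move/is_derive_eq; apply; lra.
  have := is_derive_mulf (is_derive_fourier s) e2.
  by move/is_derive_eq; apply; rewrite fourier_ode; ring.
have := is_derive_0_is_cst tau 0 G0; rewrite /G expr0n mul0r expR0 mulr1.
rewrite [X in _ = X](_ : _ = Num.sqrt pi * cos phi); last first.
  under eq_Rintegral do rewrite /kernel mul0r add0r.
  by rewrite RintegralZr ?Rintegral_gauss//; exact: integrable_gauss.
by move=> <-; rewrite -mulrA -expRD subrr expR0 mulr1.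
Qed.

Lemma integrable_gauss_cos (tau : R) : mu.-integrable setT
  (EFin \o (fun t => gauss t * cos (tau * (t - m) + phi))).
Proof. exact: integrable_kernel. Qed.

End phase.

End gauss_fourier.

(** * Integrals of complex functions and of tensor products *)

Section normc_bounds.
Context {R : realType}.
Implicit Types z : R[i].

Lemma normc_sqr z : (normc z) ^+ 2 = complex.Re z ^+ 2 + complex.Im z ^+ 2.
Proof. by case: z => a b /=; rewrite sqr_sqrtr// addr_ge0 ?sqr_ge0. Qed.

Lemma normc_ge0 z : 0 <= normc z.
Proof. by case: z => a b; rewrite sqrtr_ge0. Qed.

Lemma Re_le_normc z : `|complex.Re z| <= normc z.
Proof.
rewrite -ler_sqr ?nnegrE ?normc_ge0// normc_sqr real_normK ?num_real//.
by rewrite lerDl sqr_ge0.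
Qed.

Lemma Im_le_normc z : `|complex.Im z| <= normc z.
Proof.
rewrite -ler_sqr ?nnegrE ?normc_ge0// normc_sqr real_normK ?num_real//.
by rewrite lerDr sqr_ge0.
Qed.

Lemma normc_le_ReIm z : normc z <= `|complex.Re z| + `|complex.Im z|.
Proof.
rewrite -ler_sqr ?nnegrE ?normc_ge0 ?addr_ge0// normc_sqr sqrrD.
rewrite !real_normK ?num_real// [X in _ <= X]addrAC lerDl.
by rewrite mulrn_wge0// mulr_ge0.
Qed.

Lemma normcC (r : R) : normc r%:C = `|r|.
Proof. by rewrite /= expr0n addr0 sqrtr_sqr. Qed.

Lemma normc_cis (t : R) : normc (cis t) = 1.
Proof. by rewrite /= cos2Dsin2 sqrtr1. Qed.

Lemma normc_prod (I : Type) (s : seq I) (P : pred I) (f : I -> R[i]) :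
  normc (\prod_(i <- s | P i) f i) = \prod_(i <- s | P i) normc (f i).
Proof.
elim/big_rec2: _ => [|i x y _ <-]; first exact: ComplexField.Normc.normc1.
exact: ComplexField.Normc.normcM.
Qed.

End normc_bounds.

Section cintegrable.
Context {R : realType} d (T : measurableType d).
Implicit Types (mu : {measure set T -> \bar R}) (f : T -> R[i]).

Definition cintegrable mu f :=
  mu.-integrable setT (fun x => (complex.Re (f x))%:E) /\
  mu.-integrable setT (fun x => (complex.Im (f x))%:E).

Lemma cintegral_real mu (f : T -> R) :
  cintegral mu (fun x => (f x)%:C) = (\int[mu]_x f x)%:C.
Proof.
rewrite /cintegral/= [X in _ +i* X](_ : _ = 0)//.
by rewrite /Rintegral integral0_eq.
Qed.

Lemma cintegrable_real mu (f : T -> R) :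
  mu.-integrable setT (EFin \o f) -> cintegrable mu (fun x => (f x)%:C).
Proof. by split => //=; exact: integrable0. Qed.

End cintegrable.

Section integral_tensor.
Context {R : realType} d1 d2 (T1 : measurableType d1) (T2 : measurableType d2).
Variables (m1 : {sigma_finite_measure set T1 -> \bar R})
          (m2 : {sigma_finite_measure set T2 -> \bar R}).
Local Notation m12 := (m1 \x m2)%E.

Section real.
Variables (f : T1 -> R) (g : T2 -> R).
Hypotheses (intf : m1.-integrable setT (EFin \o f))
           (intg : m2.-integrable setT (EFin \o g)).

Lemma integrable_tensor :
  m12.-integrable setT (fun z => (f z.1 * g z.2)%:E).
Proof.
have mf : measurable_fun setT f.
  by apply/measurable_EFinP; exact: measurable_int intf.
have mg : measurable_fun setT g.
  by apply/measurable_EFinP; exact: measurable_int intg.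
have mfg : measurable_fun setT (fun z : T1 * T2 => (f z.1 * g z.2)%:E).
  apply/measurable_EFinP/measurable_funM.
    exact: measurableT_comp mf measurable_fst.
  exact: measurableT_comp mg measurable_snd.
apply/(integrable12ltyP m1 m2 mfg).
under eq_integral => x _.
  under eq_integral => y _ do rewrite /= normrM EFinM.
  rewrite ge0_integralZl//; last first.
    by apply/measurable_EFinP; exact: measurableT_comp.
  over.
have Ig : (\int[m2]_y `|g y|%:E)%E \is a fin_num.
  have /integrableP[_] := intg.
  by rewrite /= ge0_fin_numE// integral_ge0.
rewrite -(fineK Ig).
rewrite ge0_integralZr//; last 2 first.
- by apply/measurable_EFinP; exact: measurableT_comp.
- by rewrite lee_fin fine_ge0// integral_ge0.
rewrite lte_mul_pinfty ?integral_ge0// ?ge0_fin_numE ?integral_ge0//.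
- by have /integrableP[] := intf.
- by rewrite ltry.
Qed.

Lemma Rintegral_tensor : \int[m12]_z (f z.1 * g z.2) =
  (\int[m1]_x f x) * (\int[m2]_y g y).
Proof.
rewrite {1}/Rintegral -(integral12_prod_meas1 integrable_tensor) /fubini_F/=.
under eq_integral => x _.
  under eq_integral => y _ do rewrite EFinM.
  rewrite integralZl//.
  rewrite (_ : (\int[m2]_y (g y)%:E)%E = (\int[m2]_y g y)%:E); last first.
    by rewrite fineK// integrable_fin_num.
  over.
rewrite integralZr// fineM//=.
exact: integrable_fin_num.
Qed.

End real.

Section complex.
Variables (f : T1 -> R[i]) (g : T2 -> R[i]).
Hypotheses (intf : cintegrable m1 f) (intg : cintegrable m2 g).

Lemma cintegrable_tensor : cintegrable m12 (fun z => f z.1 * g z.2).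
Proof.
have [[f1 f2] [g1 g2]] := (intf, intg); split.
- have := integrableB measurableT (integrable_tensor f1 g1)
    (integrable_tensor f2 g2).
  apply: eq_integrable => // z _.
  by case: (f z.1) (g z.2) => [a b] [c e].
- have := integrableD measurableT (integrable_tensor f1 g2)
    (integrable_tensor f2 g1).
  apply: eq_integrable => // z _.
  by case: (f z.1) (g z.2) => [a b] [c e].
Qed.

Lemma cintegral_tensor : cintegral m12 (fun z => f z.1 * g z.2) =
  cintegral m1 f * cintegral m2 g.
Proof.
have [[f1 f2] [g1 g2]] := (intf, intg).
have i11 := integrable_tensor f1 g1; have i22 := integrable_tensor f2 g2.
have i12 := integrable_tensor f1 g2; have i21 := integrable_tensor f2 g1.
rewrite {2 3}/cintegral /GRing.mul/=; congr (_ +i* _).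
- rewrite -!Rintegral_tensor// -RintegralB//.
  by apply: eq_Rintegral => z _; case: (f z.1) (g z.2) => [a b] [c e].
- rewrite -!Rintegral_tensor// -RintegralD//.
  by apply: eq_Rintegral => z _; case: (f z.1) (g z.2) => [a b] [c e].
Qed.

End complex.
End integral_tensor.

Section integral_prod_rV.
Context {R : realType}.

(** Change of variables for a pushforward. Measurability of [F] is recovered from that of its
    composite with [cons_rV] through the measurable inverse [uncons_rV]. *)
Lemma cintegral_cons_measure n (m : {sigma_finite_measure set 'rV[R]_n -> \bar R})
    (F : 'rV[R]_n.+1 -> R[i]) :
  cintegrable (@lebesgue_measure R \x m)%E (F \o @cons_rV R n) ->
  cintegrable (cons_measure m) F /\
  cintegral (cons_measure m) F =
    cintegral (@lebesgue_measure R \x m)%E (F \o @cons_rV R n).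
Proof.
have unconsK : cancel (@uncons_rV R n) (@cons_rV R n).
  move=> y; apply/rowP => i; rewrite /cons_rV !mxE.
  by case: unliftP => [j|] -> /=; rewrite ?mxE.
have push (G : 'rV[R]_n.+1 -> R) :
    (@lebesgue_measure R \x m)%E.-integrable setT (EFin \o (G \o @cons_rV R n)) ->
    (cons_measure m).-integrable setT (EFin \o G) /\
    (\int[cons_measure m]_x (EFin \o G) x =
     \int[@lebesgue_measure R \x m]_x (EFin \o (G \o @cons_rV R n)) x)%E.
  move=> iG.
  have mG : measurable_fun setT (EFin \o G).
    rewrite (_ : _ \o _ = (EFin \o (G \o @cons_rV R n)) \o @uncons_rV R n).
      exact: measurableT_comp (measurable_int _ iG) (@measurable_uncons_rV R n).
    by apply/funext => y /=; rewrite unconsK.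
  split; first exact: (integrable_pushforward (@measurable_cons_rV R n) mG iG).
  exact: (integral_pushforward (@measurable_cons_rV R n) mG iG).
case=> /(push (fun y => complex.Re (F y)))[i1 e1].
move=> /(push (fun y => complex.Im (F y)))[i2 e2]; split; first by split.
by congr (fine _ +i* fine _).
Qed.

(** Fubini, by induction along the recursive definition of [lebesgue_rV]. In dimension 0 the measure
    is a Dirac mass and the empty product is 1. *)
Lemma cintegral_prod_rV n (f : 'I_n -> R -> R[i]) :
  (forall i, cintegrable (@lebesgue_measure R) (f i)) ->
  cintegrable (lebesgue_rV n) (fun y => \prod_i f i (y 0 i)) /\
  cintegral (lebesgue_rV n) (fun y => \prod_i f i (y 0 i)) =
    \prod_i cintegral (@lebesgue_measure R) (f i).
Proof.
elim: n f => [|n IHn] f fi.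
  have E : (fun y : 'rV[R]_0 => \prod_i f i (y 0 i)) = fun=> 1%:C.
    by apply/funext => y; rewrite big_ord0.
  rewrite E big_ord0; split.
    by apply: cintegrable_real; exact:
      (finite_measure_integrable_cst (\d_(0 : 'rV[R]_0)) 1 measurableT).
  rewrite cintegral_real /Rintegral integral_dirac//.
  by rewrite diracE in_setT mul1e.
have [iF eF] := IHn (fun i => f (lift ord0 i)) (fun i => fi _).
have E : (fun y : 'rV[R]_n.+1 => \prod_i f i (y 0 i)) \o @cons_rV R n =
    fun p => f ord0 p.1 * \prod_i f (lift ord0 i) (p.2 0 i).
  apply/funext => p /=; rewrite big_ord_recl /cons_rV !mxE unlift_none.
  by congr (_ * _); apply: eq_bigr => i _; rewrite mxE liftK.
have := @cintegral_cons_measure n (lebesgue_rV n)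
  (fun y : 'rV[R]_n.+1 => \prod_i f i (y 0 i)).
rewrite E => /(_ (cintegrable_tensor (fi ord0) iF))[i1 e1].
split => //; rewrite big_ord_recl -eF.
by rewrite -(cintegral_tensor (fi ord0) iF) -e1.
Qed.

End integral_prod_rV.

(** * Integral bounds from almost everywhere domination *)

Section dominated_integral.
Context {R : realType} d (T : measurableType d).
Variable mu : {measure set T -> \bar R}.

Lemma ge0_le_nonmeasurable_integral (f g : T -> \bar R) :
  (forall x, 0 <= f x)%E -> (forall x, f x <= g x)%E ->
  (\int[mu]_x f x <= \int[mu]_x g x)%E.
Proof.
(* The integral of a nonnegative function is a supremum over the simple functions
   below it, whether or not the function is measurable. *)
move=> f0 fg; have g0 x : (0 <= g x)%E := le_trans (f0 x) (fg x).
rewrite !ge0_integralTE//; apply: ereal_sup_le.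
by move=> _ [h /= hf <-]; exists h => // x; exact: le_trans (hf x) (fg x).
Qed.

(** The integrals of the positive and of the negative part of [f] both lie between 0 and the
    integral of [g], hence so does the modulus of their difference. *)
Lemma ae_norm_Rintegral_le (f g : T -> R) : (forall x, 0 <= g x) ->
  mu.-integrable setT (EFin \o g) ->
  {ae mu, forall x, `|f x| <= g x} ->
  `|\int[mu]_x f x| <= \int[mu]_x g x.
Proof.
move=> g0 intg [N [mN N0 fgN]].
(* Raising the majorant to infinity on the exceptional null set makes the domination hold everywhere
   without changing the integral. *)
pose g' x : \bar R := if x \in N then +oo%E else (g x)%:E.
have mg := measurable_int _ intg.
have mg' : measurable_fun setT g'.
  apply: measurable_fun_ifT => //.
  apply: (@measurable_fun_bool _ _ _ _ true); rewrite setTI.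
  rewrite (_ : _ @^-1` _ = N)//.
  by apply/seteqP; split => x; [move/set_mem|move/mem_set].
have ig' : (\int[mu]_x g' x = \int[mu]_x (g x)%:E)%E.
  apply: ge0_ae_eq_integral => //.
  - by move=> x _; rewrite /g'; case: ifP => // _; rewrite lee_fin.
  - by move=> x _; rewrite lee_fin.
  - exists N; split => // x /=.
    by apply: contra_notP => xN _; rewrite /g' ifF//; apply/negbTE; rewrite notin_setE.
have fg' x : (`|(f x)%:E| <= g' x)%E.
  rewrite /g'; case: ifPn => [_|]; first by rewrite leey.
  rewrite notin_setE lee_fin => xN; apply: contra_notP xN => H.
  exact: fgN.
have Ig : (\int[mu]_x (g x)%:E)%E \is a fin_num by exact: integrable_fin_num.
have bpos : (\int[mu]_x (EFin \o f)^\+ x <= \int[mu]_x (g x)%:E)%E.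
  rewrite -ig'; apply: ge0_le_nonmeasurable_integral => // x.
  by apply: le_trans (fg' x); rewrite -/((abse \o (EFin \o f)) x) fune_abse leeDl.
have bneg : (\int[mu]_x (EFin \o f)^\- x <= \int[mu]_x (g x)%:E)%E.
  rewrite -ig'; apply: ge0_le_nonmeasurable_integral => // x.
  by apply: le_trans (fg' x); rewrite -/((abse \o (EFin \o f)) x) fune_abse leeDr.
have p0 : (0 <= \int[mu]_x (EFin \o f)^\+ x)%E by exact: integral_ge0.
have n0 : (0 <= \int[mu]_x (EFin \o f)^\- x)%E by exact: integral_ge0.
rewrite /Rintegral [X in fine X](integralE _ _ (EFin \o f)).
move: bpos bneg p0 n0; rewrite -(fineK Ig).
case: (\int[mu]_x (EFin \o f)^\+ x)%E => [p| |]//.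
case: (\int[mu]_x (EFin \o f)^\- x)%E => [n| |]//.
by rewrite /= !lee_fin ler_norml; lra.
Qed.

(** The factor 2 comes from estimating the real and imaginary parts separately. It is harmless,
    since a wave front set only depends on rates of decay. *)
Lemma normc_cintegral_le (f : T -> R[i]) (g : T -> R) : (forall x, 0 <= g x) ->
  mu.-integrable setT (EFin \o g) ->
  {ae mu, forall x, normc (f x) <= g x} ->
  normc (cintegral mu f) <= 2 * \int[mu]_x g x.
Proof.
move=> g0 ig fg.
have part (h : R[i] -> R) : (forall z, `|h z| <= normc z) ->
    `|\int[mu]_x h (f x)| <= \int[mu]_x g x.
  move=> hn; apply: ae_norm_Rintegral_le => //.
  by apply: filterS fg => x; exact: le_trans.
apply: (le_trans (normc_le_ReIm _)).
by rewrite [X in _ <= X]mulr_natl mulr2n lerD//; apply: part => z;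
  [exact: Re_le_normc|exact: Im_le_normc].
Qed.

End dominated_integral.

(** * The STFT of a Gabor atom *)

Section cis_conj.
Context {R : realType}.
Implicit Types (s t r : R) (z w : R[i]).

Lemma cisD s t : cis (s + t) = cis s * cis t.
Proof. by rewrite /cis cosD sinD /GRing.mul/= [cos s * sin t + _]addrC. Qed.

Lemma cis0 : cis (0 : R) = 1.
Proof. by rewrite /cis cos0 sin0. Qed.

Lemma cis_sum (I : Type) (l : seq I) (P : pred I) (f : I -> R) :
  cis (\sum_(i <- l | P i) f i) = \prod_(i <- l | P i) cis (f i).
Proof.
elim/big_rec2: _ => [|i x y _ <-]; first exact: cis0.
exact: cisD.
Qed.

Lemma conjc_cis t : conjc (cis t) = cis (- t).
Proof. by rewrite /cis cosN sinN. Qed.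

Lemma conjc_real r : conjc r%:C = r%:C.
Proof. by rewrite /= oppr0. Qed.

Lemma realCM r s : (r * s)%:C = r%:C * s%:C.
Proof. exact: rmorphM. Qed.

Lemma conjcM z w : conjc (z * w) = conjc z * conjc w.
Proof. exact: rmorphM. Qed.

Lemma realC_prod (I : Type) (l : seq I) (P : pred I) (f : I -> R) :
  (\prod_(i <- l | P i) f i)%:C = \prod_(i <- l | P i) (f i)%:C.
Proof. exact: rmorph_prod. Qed.

Lemma conjc_prod (I : Type) (l : seq I) (P : pred I) (f : I -> R[i]) :
  conjc (\prod_(i <- l | P i) f i) = \prod_(i <- l | P i) conjc (f i).
Proof. exact: rmorph_prod. Qed.

Lemma normc_conjc z : normc (conjc z) = normc z.
Proof. by case: z => a b /=; rewrite sqrrN. Qed.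

End cis_conj.

Lemma Re_scale {R : realType} (r : R) z : complex.Re (r%:C * z) = r * complex.Re z.
Proof. by case: z => a b /=; rewrite mul0r subr0. Qed.

Lemma Im_scale {R : realType} (r : R) z : complex.Im (r%:C * z) = r * complex.Im z.
Proof. by case: z => a b /=; rewrite mul0r addr0. Qed.

Section cintegral_scale.
Context {R : realType} d (T : measurableType d).
Variable mu : {measure set T -> \bar R}.

Lemma cintegral_scale (c : R) (f : T -> R[i]) : cintegrable mu f ->
  cintegral mu (fun x => c%:C * f x) = c%:C * cintegral mu f.
Proof.
move=> [i1 i2]; apply/eqP; rewrite eq_complex Re_scale Im_scale /=.
by rewrite -!RintegralZl//; apply/andP; split; apply/eqP;
  apply: eq_Rintegral => x _; rewrite ?Re_scale ?Im_scale.
Qed.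

End cintegral_scale.

Lemma cos_sub_pihalf {R : realType} (t : R) : cos (t - pi / 2) = sin t.
Proof. by rewrite cosB cos_pihalf sin_pihalf mulr0 mulr1 add0r. Qed.

(** The imaginary part is the cosine formula at phase phi - pi/2. Together the two parts show
    [cis phi] as a factor of the integral, which drops out of the modulus. *)
Lemma cintegral_gauss_cis {R : realType} (m phi tau : R) :
  let f t := (gauss m t)%:C * cis (tau * (t - m) + phi) in
  cintegrable (@lebesgue_measure R) f /\
  normc (cintegral (@lebesgue_measure R) f) =
    Num.sqrt pi * expR (- (tau ^+ 2 / 4)).
Proof.
have Re_f t : complex.Re ((gauss m t)%:C * cis (tau * (t - m) + phi)) =
    gauss m t * cos (tau * (t - m) + phi).
  by rewrite Re_scale.
have Im_f t : complex.Im ((gauss m t)%:C * cis (tau * (t - m) + phi)) =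
    gauss m t * cos (tau * (t - m) + (phi - pi / 2)).
  by rewrite Im_scale addrA cos_sub_pihalf.
split; first split.
- apply: eq_integrable (integrable_gauss_cos m phi tau) => // t _.
  by rewrite Re_f.
- apply: eq_integrable (integrable_gauss_cos m (phi - pi / 2) tau) => // t _.
  by rewrite Im_f.
rewrite /cintegral.
under eq_Rintegral do rewrite Re_f.
under [X in _ +i* X]eq_Rintegral do rewrite Im_f.
rewrite !gauss_fourier.
rewrite cos_sub_pihalf.
have -> : (Num.sqrt pi * cos phi * expR (- (tau ^+ 2 / 4)) +i*
    (Num.sqrt pi * sin phi * expR (- (tau ^+ 2 / 4)))) =
    (Num.sqrt pi * expR (- (tau ^+ 2 / 4)))%:C * cis phi.
  by apply/eqP; rewrite eq_complex Re_scale Im_scale /= ![_ * _ * expR _]mulrAC !eqxx.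
by rewrite ComplexField.Normc.normcM normcC normc_cis mulr1 ger0_norm.
Qed.

Section gabor.
Context {R : realType} {d : nat}.
Implicit Types z : 'rV[R]_d * 'rV[R]_d.

Definition normsq z : R := dotp z.1 z.1 + dotp z.2 z.2.

Definition gabor1 (x xi t : R) : R[i] :=
  (expR (- ((t - x) ^+ 2 / 2)))%:C * cis (- (xi * t)).

(** The test function that [stft] feeds to a functional at the point [z]. *)
Definition gabor z (y : 'rV[R]_d) : R[i] :=
  (gauss_window (y - z.1))%:C * cis (- dotp z.2 y).

Lemma dotp_ge0 (x : 'rV[R]_d) : 0 <= dotp x x.
Proof. by apply: sumr_ge0 => i _; rewrite -expr2 sqr_ge0. Qed.

Lemma enorm_sqr (x : 'rV[R]_d) : enorm x ^+ 2 = dotp x x.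
Proof. by rewrite sqr_sqrtr// dotp_ge0. Qed.

Lemma gaborE z y : gabor z y = (pi `^ (- (d%:R / 4)))%:C *
  \prod_i gabor1 (z.1 0 i) (z.2 0 i) (y 0 i).
Proof.
rewrite /gabor /gauss_window enorm_sqr big_split/= -realC_prod -cis_sum.
rewrite sumrN mulrA; congr (_ * _).
rewrite -expR_sum sumrN -realCM; congr (_ * expR (- _))%:C.
rewrite -mulr_suml; congr (_ / _).
by apply: eq_bigr => i _; rewrite !mxE expr2.
Qed.

(** Completing the square: with m the midpoint of x1 and x, (t - x1)^2 / 2 + (t - x)^2 / 2 = (t -
    m)^2 + (x1 - x)^2 / 4. The phase is recentred at m to fit [cintegral_gauss_cis]. *)
Lemma gabor1_conj_mul (x1 xi1 x xi t : R) :
  conjc (gabor1 x1 xi1 t) * gabor1 x xi t =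
  (expR (- ((x1 - x) ^+ 2 / 4)))%:C *
  ((gauss ((x1 + x) / 2) t)%:C *
   cis ((xi1 - xi) * (t - (x1 + x) / 2) + (xi1 - xi) * ((x1 + x) / 2))).
Proof.
rewrite /gabor1 conjcM conjc_cis conjc_real mulrACA -realCM -cisD -expRD.
rewrite [in RHS]mulrA -realCM -expRD.
by congr ((expR _)%:C * cis _); lra.
Qed.

(** The conjugate is the one that [localization_op] introduces. The integral factors over the
    coordinates; position differences enter through the completed square, frequency differences
    through the Fourier transform, both with rate 1/4. *)
Lemma stft_gabor z1 z :
  normc (stft (regular_functional (fun y => conjc (gabor z1 y))) z) =
  (2 * pi) `^ (- (d%:R / 2)) * expR (- (normsq (z1 - z) / 4)).
Proof.
rewrite /stft ComplexField.Normc.normcM normcC ger0_norm ?powR_ge0//.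
congr (_ * _); rewrite /regular_functional.
pose c : R := pi `^ (- (d%:R / 4)).
pose e i := expR (- ((z1.1 0 i - z.1 0 i) ^+ 2 / 4)) : R.
pose m i := (z1.1 0 i + z.1 0 i) / 2.
pose tau i := z1.2 0 i - z.2 0 i.
pose h i t := (gauss (m i) t)%:C * cis (tau i * (t - m i) + tau i * m i).
have h_int i : cintegrable (@lebesgue_measure R) (h i) /\
    normc (cintegral (@lebesgue_measure R) (h i)) =
      Num.sqrt pi * expR (- (tau i ^+ 2 / 4)).
  exact: (cintegral_gauss_cis (m i) (tau i * m i) (tau i)).
have [intF intE] := cintegral_prod_rV (fun i => (h_int i).1).
have -> : (fun y => conjc (gabor z1 y) *
     ((gauss_window (y - z.1))%:C * cis (- dotp z.2 y))) =
    fun y => (c * c * \prod_i e i)%:C * \prod_i h i (y 0 i).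
  apply/funext => y; rewrite -/(gabor z y) !gaborE -/c conjcM conjc_real.
  rewrite conjc_prod mulrACA -big_split/= [in RHS]realCM -[in RHS]mulrA.
  rewrite -realCM realC_prod -big_split/=; congr (_ * _).
  by apply: eq_bigr => i _; rewrite gabor1_conj_mul.
rewrite (cintegral_scale _ intF) intE ComplexField.Normc.normcM normcC.
rewrite normc_prod.
rewrite [X in _ * X = _]
  (eq_bigr (fun i => Num.sqrt pi * expR (- (tau i ^+ 2 / 4)))); last first.
  by move=> i _; exact: (h_int i).2.
rewrite big_split/= prodr_const card_ord /e -!expR_sum.
have -> : Num.sqrt pi ^+ d = pi `^ (d%:R / 2) :> R.
  by rewrite -powR12_sqrt ?pi_ge0// -powR_mulrn ?powR_ge0// -powRrM mulrC.
rewrite ger0_norm ?mulr_ge0 ?powR_ge0 ?expR_ge0// mulrACA -expRD.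
have pi_neq0 : (pi : R) != 0 by rewrite gt_eqF ?pi_gt0.
(* The powers of pi cancel: - d/4 from each of the two atoms and d/2 from the [d] Gaussian
   integrals. *)
rewrite /c -!powRD ?pi_neq0 ?implybT// [X in pi `^ X](_ : _ = 0); last by lra.
rewrite powRr0 mul1r; congr expR; rewrite !sumrN -opprD -!mulr_suml -mulrDl.
by congr (- (_ / _)); congr (_ + _); apply: eq_bigr => i _; rewrite !mxE expr2.
Qed.

End gabor.

(** * Derivatives of a one-dimensional Gabor atom *)

Section Re_Im.
Context {R : realType}.
Implicit Types z w : R[i].

Lemma Re_add z w : complex.Re (z + w) = complex.Re z + complex.Re w.
Proof. by case: z w => ? ? []. Qed.

Lemma Im_add z w : complex.Im (z + w) = complex.Im z + complex.Im w.
Proof. by case: z w => ? ? []. Qed.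

Lemma Re_mul z w : complex.Re (z * w) =
  complex.Re z * complex.Re w - complex.Im z * complex.Im w.
Proof. by case: z w => ? ? []. Qed.

Lemma Im_mul z w : complex.Im (z * w) =
  complex.Re z * complex.Im w + complex.Im z * complex.Re w.
Proof. by case: z w => ? ? []. Qed.

Lemma normc_opp z : normc (- z) = normc z.
Proof. by case: z => a b /=; rewrite !sqrrN. Qed.

End Re_Im.

Section cderive.
Context {R : realType}.
Implicit Types (f g : R -> R[i]) (t : R) (a b : R[i]).

(** Stated by components because [smooth] and [mi_partial] differentiate the real and imaginary
    parts separately. *)
Definition cderive f t a :=
  is_derive t 1 (fun s => complex.Re (f s)) (complex.Re a) /\
  is_derive t 1 (fun s => complex.Im (f s)) (complex.Im a).

Lemma cderive_eq f t a b : cderive f t a -> a = b -> cderive f t b.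
Proof. by move=> fa <-. Qed.

Lemma cderive_cst a t : cderive (fun=> a) t 0.
Proof. by split; exact: is_derive_cst. Qed.

Lemma cderiveD f g t a b : cderive f t a -> cderive g t b ->
  cderive (fun s => f s + g s) t (a + b).
Proof.
move=> [f1 f2] [g1 g2]; split.
- have := is_derive_addf f1 g1; rewrite -Re_add.
  by congr is_derive; apply/funext => s; rewrite Re_add.
- have := is_derive_addf f2 g2; rewrite -Im_add.
  by congr is_derive; apply/funext => s; rewrite Im_add.
Qed.

Lemma cderiveM f g t a b : cderive f t a -> cderive g t b ->
  cderive (fun s => f s * g s) t (a * g t + f t * b).
Proof.
move=> [f1 f2] [g1 g2]; split.
- have := is_derive_subf (is_derive_mulf f1 g1) (is_derive_mulf f2 g2).
  rewrite (_ : (fun s => complex.Re (f s * g s)) = fun s =>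
    complex.Re (f s) * complex.Re (g s) - complex.Im (f s) * complex.Im (g s)).
    by move/is_derive_eq; apply; rewrite Re_add !Re_mul; ring.
  by apply/funext => s; rewrite Re_mul.
- have := is_derive_addf (is_derive_mulf f1 g2) (is_derive_mulf f2 g1).
  rewrite (_ : (fun s => complex.Im (f s * g s)) = fun s =>
    complex.Re (f s) * complex.Im (g s) + complex.Im (f s) * complex.Re (g s)).
    by move/is_derive_eq; apply; rewrite Im_add !Im_mul; ring.
  by apply/funext => s; rewrite Im_mul.
Qed.

Lemma cderive_scale (c : R[i]) f t a : cderive f t a ->
  cderive (fun s => c * f s) t (c * a).
Proof.
move=> fa; apply: cderive_eq (cderiveM (cderive_cst c t) fa) _.
by rewrite mul0r add0r.
Qed.

Lemma cderive_shift f (x t : R) a : cderive f (t + x) a ->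
  cderive (fun s => f (s + x)) t a.
Proof.
have shiftx : is_derive (t : R) 1 (fun s : R => s + x) 1.
  have := is_derive_affine 1 x t.
  by congr is_derive; apply/funext => s; rewrite mul1r.
move=> [f1 f2]; split; rewrite -[X in is_derive _ _ _ X]mulr1.
- by have := @is_derive1_comp _ _ (fun s : R => s + x) _ _ _ f1 shiftx.
- by have := @is_derive1_comp _ _ (fun s : R => s + x) _ _ _ f2 shiftx.
Qed.

End cderive.

(* Up to the sign (-1)^n this is the n-th Hermite polynomial in t - x + i xi
   times the function being differentiated. *)
Fixpoint gabor1_deriv {R : realType} (x xi : R) (n : nat) (t : R) : R[i] :=
  match n with
  | 0 => gabor1 x xi t
  | k.+1 => - (((t - x) +i* xi) * gabor1_deriv x xi k t) -
      match k with
      | 0 => 0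
      | l.+1 => k%:R * gabor1_deriv x xi l t
      end
  end.

Section gabor1.
Context {R : realType}.
Variables x xi : R.
Local Notation D := (gabor1_deriv x xi).

Lemma gabor1_deriv1 t : D 1 t = - (((t - x) +i* xi) * gabor1 x xi t).
Proof. by rewrite /= subr0. Qed.

Lemma gabor1_derivSS n t : D n.+2 t =
  - (((t - x) +i* xi) * D n.+1 t) - n.+1%:R * D n t.
Proof. by []. Qed.

Lemma cderive_gabor1 t : cderive (gabor1 x xi) t (D 1 t).
Proof.
have dexp : is_derive t 1 (fun s : R => expR (- ((s - x) ^+ 2 / 2)))
    (- (t - x) * expR (- ((t - x) ^+ 2 / 2))).
  apply: is_derive_expR_comp.
  have -> : (fun s : R => - ((s - x) ^+ 2 / 2)) =
      fun s => ((- 2^-1) * s + x / 2) * (1 * s + - x).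
    by apply/funext => s; field.
  have := is_derive_mulf (is_derive_affine (- 2^-1) (x / 2) t)
    (is_derive_affine 1 (- x) t).
  by move/is_derive_eq; apply; field.
have dphase : is_derive t 1 (fun s : R => - (xi * s)) (- xi).
  have := is_derive_affine (- xi) 0 t.
  by congr is_derive; apply/funext => s; ring.
have dwin : cderive (fun s : R => (expR (- ((s - x) ^+ 2 / 2)))%:C) t
    (- (t - x) * expR (- ((t - x) ^+ 2 / 2)))%:C.
  by split => //=; exact: is_derive_cst.
have dcis : cderive (fun s : R => cis (- (xi * s))) t
    ((- xi)%:C * 'i%C * cis (- (xi * t))).
  split.
    apply: is_derive_eq (is_derive_cos_comp dphase) _.
    by rewrite /=; ring.
  apply: is_derive_eq (is_derive_sin_comp dphase) _.
  by rewrite /=; ring.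
apply: cderive_eq (cderiveM dwin dcis) _.
rewrite /= subr0 /gabor1.
set e := expR _; set c := cis _.
have -> : (t - x) +i* xi = (t - x)%:C + xi%:C * 'i%C.
  by apply/eqP; rewrite eq_complex /= !mul0r !mulr0 !mulr1 !(subr0, addr0, add0r) !eqxx.
by rewrite realCM !rmorphN/=; ring.
Qed.

(** Strong induction on the recurrence. Differentiating the factor - (t - x + i xi) yields one more
    copy of - [D n.+1], which raises the coefficient n + 1 to n + 2. *)
Lemma cderive_gabor1_deriv n t : cderive (D n) t (D n.+1 t).
Proof.
have dw s : cderive (fun s : R => - ((s - x) +i* xi)) s (- 1).
  split.
    have := is_derive_affine (-1) x s.
    by congr is_derive; apply/funext => r /=; ring.
  by rewrite /= oppr0; exact: is_derive_cst.
elim/ltn_ind: n => -[|[|n]] IH; first exact: cderive_gabor1.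
  have -> : D 1 = fun s => - ((s - x) +i* xi) * D 0 s.
    by apply/funext => s; rewrite gabor1_deriv1 mulNr.
  apply: cderive_eq (cderiveM (dw t) (IH 0 isT)) _.
  by rewrite /=; ring.
have -> : D n.+2 = fun s => - ((s - x) +i* xi) * D n.+1 s + (- n.+1%:R) * D n s.
  by apply/funext => s; rewrite gabor1_derivSS !mulNr.
apply: cderive_eq (cderiveD (cderiveM (dw t) (IH n.+1 _))
  (cderive_scale (- n.+1%:R) (IH n _))) _; rewrite ?ltnS ?leqnSn//.
by rewrite [D n.+3 t]gabor1_derivSS -[n.+2%:R]natr1; ring.
Qed.

(** The product b_n is shaped so that the three-term recurrence closes: n + 1 <= sqrt (n + 1) sqrt
    (n + 2) and sqrt (n + 1) b_n <= b_(n+1) give (n + 1) b_n <= sqrt (n + 2) b_(n+1). *)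
Lemma normc_gabor1_deriv n t : normc (D n t) <=
  (\prod_(k < n) (Num.sqrt k.+1%:R + normc ((t - x) +i* xi))) *
  normc (gabor1 x xi t).
Proof.
set N := normc (gabor1 x xi t); set w := (t - x) +i* xi; set r := normc w.
pose b n := \prod_(k < n) (Num.sqrt (k.+1%:R : R) + r).
have r0 : 0 <= r by exact: normc_ge0.
have bS k : b k.+1 = b k * (Num.sqrt k.+1%:R + r) by rewrite /b big_ord_recr.
have b0 k : 0 <= b k by apply: prodr_ge0 => i _; rewrite addr_ge0 ?sqrtr_ge0.
rewrite -/(b n); elim/ltn_ind: n => -[|[|n]] IH.
- by rewrite /b big_ord0 mul1r.
- rewrite bS /b big_ord0 mul1r sqrtr1 gabor1_deriv1 normc_opp.
  rewrite ComplexField.Normc.normcM -/w -/r.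
  by rewrite ler_wpM2r ?normc_ge0// lerDr.
rewrite gabor1_derivSS -/w.
apply: (le_trans (le_normcD _ _)).
rewrite !normc_opp !ComplexField.Normc.normcM.
have -> : normc (n.+1%:R : R[i]) = n.+1%:R.
  by rewrite -(rmorph_nat (real_complex R)) normcC ger0_norm.
have s0 := sqrtr_ge0 (n.+1%:R : R).
have ss : n.+1%:R <= Num.sqrt n.+1%:R * Num.sqrt n.+2%:R :> R.
  rewrite -sqrtrM// -[X in X <= _](ger0_norm (ler0n _ _)) -sqrtr_sqr ler_sqrt;
    last by rewrite mulr_ge0.
  by rewrite expr2 ler_wpM2l// ler_nat.
have N0 : 0 <= N by exact: normc_ge0.
apply: (@le_trans _ _ (r * (b n.+1 * N) + n.+1%:R * (b n * N))).
  by rewrite lerD// ler_wpM2l//; exact: IH.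
have H : n.+1%:R * b n <= b n.+1 * Num.sqrt n.+2%:R.
  apply: (@le_trans _ _ (b n * (Num.sqrt n.+1%:R * Num.sqrt n.+2%:R))).
    by rewrite mulrC ler_wpM2l.
  by rewrite bS mulrA ler_wpM2r ?sqrtr_ge0// ler_wpM2l// lerDl.
have -> : r * (b n.+1 * N) + n.+1%:R * (b n * N) =
    (r * b n.+1 + n.+1%:R * b n) * N by ring.
by apply: ler_wpM2r => //; rewrite [b n.+2]bS; lra.
Qed.

Lemma normc_gabor1 t : normc (gabor1 x xi t) ^+ 2 = expR (- (t - x) ^+ 2).
Proof.
rewrite /gabor1 ComplexField.Normc.normcM normcC normc_cis mulr1.
by rewrite ger0_norm ?expR_ge0// -expRM_natl; congr expR; field.
Qed.

End gabor1.

Lemma exprn_le_fact_expR {R : realType} (n : nat) (a : R) :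
  0 <= a -> a ^+ n <= n`!%:R * expR a.
Proof.
move=> a0; case: n => [|n].
  by rewrite expr0 fact0 mul1r; have := expR_ge1Dx a; lra.
rewrite mulrC -ler_pdivrMr ?ltr0n ?fact_gt0//.
by have := expR_ge1Dxn n a0; lra.
Qed.

(* [(\sqrt k + r)^2 <= 2 M (k + r^2 / M)], and the product over [1 <= k <= n] of
   [k + Y] is at most [(n + Y)^n <= n! e^(n + Y)]. *)
Lemma prod_sqrt_add_sqr_le {R : realType} (M r : R) n : 1 <= M -> 0 <= r ->
  (\prod_(k < n) (Num.sqrt k.+1%:R + r)) ^+ 2 <=
  (2 * M) ^+ n * (n`!%:R * expR (n%:R + r ^+ 2 / M)).
Proof.
move=> M1 r0; have M0 : 0 < M by lra.
have Y0 : 0 <= r ^+ 2 / M by rewrite divr_ge0 ?sqr_ge0// ltW.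
have nY : 0 <= n%:R + r ^+ 2 / M by rewrite addr_ge0.
apply: (@le_trans _ _ (\prod_(k < n) (2 * M * (n%:R + r ^+ 2 / M)))); last first.
  rewrite prodr_const card_ord exprMn ler_wpM2l ?exprn_ge0//; first by lra.
  exact: exprn_le_fact_expR.
rewrite -prodrXl; apply: ler_prod => k _; rewrite sqr_ge0/=.
apply: (@le_trans _ _ (2 * (k.+1%:R + r ^+ 2))).
  have := sqr_ge0 (Num.sqrt k.+1%:R - r).
  by rewrite sqrrB sqrrD sqr_sqrtr//; lra.
rewrite -mulrA ler_wpM2l// mulrDr mulrCA divff ?gt_eqF// mulr1 lerD2r.
apply: (@le_trans _ _ n%:R); first by rewrite ler_nat.
by rewrite ler_peMl.
Qed.

(** The parameter [M] trades the radius of the step against growth: powers of [t] and Hermite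
    factors cost a power of 2 e M, where e stems from (n + Y)^n <= n! exp (n + Y), and leave only a
    growth rate of 2 / M. Squares avoid the square roots. *)
Lemma gabor1_seminorm {R : realType} (M x xi t : R) (k n : nat) : 3 <= M ->
  (`|t| ^+ k * normc (gabor1_deriv x xi n t)) ^+ 2 <=
  (k`! * n`!)%:R * (2 * expR 1 * M) ^+ (k + n) *
  expR (2 / M * (x ^+ 2 + xi ^+ 2)).
Proof.
move=> M3; have M0 : 0 < M by lra.
have e1 : 1 <= expR (1 : R) by have := expR_ge1Dx (1 : R); lra.
have tk : (`|t| ^+ k) ^+ 2 <= (2 * expR 1 * M) ^+ k * (k`!%:R * expR (t ^+ 2 / M)).
  rewrite -exprM mulnC exprM real_normK ?num_real//.
  have tM : 0 <= t ^+ 2 / M by rewrite divr_ge0 ?sqr_ge0// ltW.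
  have -> : (t ^+ 2) ^+ k = M ^+ k * (t ^+ 2 / M) ^+ k.
    by rewrite -exprMn mulrCA divff ?gt_eqF// mulr1.
  apply: ler_pM; rewrite ?exprn_ge0//; [exact: ltW| |exact: exprn_le_fact_expR].
  by rewrite lerXn2r ?nnegrE//; [exact: ltW|nra|nra].
have gn : normc (gabor1_deriv x xi n t) ^+ 2 <=
    (2 * M) ^+ n * (n`!%:R * expR (n%:R + ((t - x) ^+ 2 + xi ^+ 2) / M)) *
    expR (- (t - x) ^+ 2).
  have w2 : normc ((t - x) +i* xi) ^+ 2 = (t - x) ^+ 2 + xi ^+ 2 by rewrite normc_sqr.
  rewrite -(normc_gabor1 x xi) -w2.
  apply: (le_trans (y := ((\prod_(k < n) (Num.sqrt k.+1%:R +
      normc ((t - x) +i* xi))) * normc (gabor1 x xi t)) ^+ 2)).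
    by rewrite lerXn2r ?nnegrE ?normc_ge0 ?mulr_ge0 ?normc_ge0 ?normc_gabor1_deriv//;
      apply: prodr_ge0 => i _; rewrite addr_ge0 ?sqrtr_ge0 ?normc_ge0.
  rewrite exprMn ler_wpM2r ?sqr_ge0//.
  by apply: prod_sqrt_add_sqr_le; [lra|exact: normc_ge0].
rewrite exprMn; apply: (le_trans (ler_pM (sqr_ge0 _) (sqr_ge0 _) tk gn)).
have -> : (2 * expR 1 * M) ^+ k * (k`!%:R * expR (t ^+ 2 / M)) *
    ((2 * M) ^+ n * (n`!%:R * expR (n%:R + ((t - x) ^+ 2 + xi ^+ 2) / M)) *
     expR (- (t - x) ^+ 2)) = (k`! * n`!)%:R * (2 * expR 1 * M) ^+ (k + n) *
    expR (t ^+ 2 / M + ((t - x) ^+ 2 + xi ^+ 2) / M - (t - x) ^+ 2).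
  have en : expR (n%:R : R) = expR 1 ^+ n by rewrite -expRM_natl mulr1.
  rewrite !expRD natrM exprD en !exprMn; ring.
rewrite ler_wpM2l ?mulr_ge0 ?exprn_ge0//; [nra|].
rewrite ler_expR.
have t2 : t ^+ 2 / M <= (2 * x ^+ 2 + 2 * (t - x) ^+ 2) / M.
  rewrite ler_wpM2r ?invr_ge0 ?(ltW M0)//.
  by rewrite -subr_ge0 (_ : _ - _ = (t - 2 * x) ^+ 2) ?sqr_ge0//; ring.
(* Here [3 <= M] enters: two multiples of (t - x)^2 / M come from t^2 and one from the derivative,
   and exp (- (t - x)^2) absorbs all three. *)
have vM : (t - x) ^+ 2 / M <= (t - x) ^+ 2 / 3.
  by rewrite ler_wpM2l ?sqr_ge0// lef_pV2// posrE.
have xiM : 0 <= xi ^+ 2 / M by rewrite divr_ge0 ?sqr_ge0// ltW.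
by have := sqr_ge0 (t - x); move: t2 vM xiM; rewrite !mulrDl mulrDr -!mulrA
  ![M^-1 * _]mulrC; lra.
Qed.

(** * Gelfand-Shilov norms of Gabor atoms *)

Section is_derive_line.
Context {R : realType} {V : normedModType R}.

Lemma is_derive_line (f : V -> R) (x v : V) (l : R) :
  is_derive (0 : R) 1 (fun h : R => f (h *: v + x)) l -> is_derive x v f l.
Proof.
move=> [df fl]; apply: DeriveDef; first exact/derivable1P.
rewrite -fl /derive; congr (lim (_ @ 0^')); apply/funext => h /=.
by rewrite scale0r add0r addr0 [_%:A]mulr1.
Qed.

End is_derive_line.

Section ccontinuous.
Context {R : realType} {T : topologicalType}.
Implicit Types f g : T -> R[i].

Definition ccontinuous f :=
  continuous (fun x => complex.Re (f x)) /\
  continuous (fun x => complex.Im (f x)).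

Lemma ccontinuous_cst (c : R[i]) : ccontinuous (fun=> c).
Proof. by split => x; exact: cvg_cst. Qed.

Lemma ccontinuousM f g : ccontinuous f -> ccontinuous g ->
  ccontinuous (fun x => f x * g x).
Proof.
move=> [f1 f2] [g1 g2]; split.
- under eq_fun do rewrite Re_mul.
  move=> x; apply: cvgB; exact: continuous_mulf.
- under eq_fun do rewrite Im_mul.
  by apply: continuous_addf; exact: continuous_mulf.
Qed.

Lemma ccontinuous_prod (I : Type) (s : seq I) (F : I -> T -> R[i]) :
  (forall i, ccontinuous (F i)) -> ccontinuous (fun x => \prod_(i <- s) F i x).
Proof.
move=> cF; elim: s => [|i s IHs].
  by under eq_fun do rewrite big_nil; exact: ccontinuous_cst.
under eq_fun do rewrite big_cons.
exact: ccontinuousM.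
Qed.

End ccontinuous.

Section gabor_deriv.
Context {R : realType} {d : nat}.
Variable z : 'rV[R]_d * 'rV[R]_d.
Implicit Types (y : 'rV[R]_d) (beta : 'I_d -> nat) (K : R).

(** With [K] free, the family contains the atoms, their real multiples and the zero function, as the
    scaling argument of [stft_growth] requires. *)
Definition gabor_deriv K beta y : R[i] :=
  K%:C * \prod_i gabor1_deriv (z.1 0 i) (z.2 0 i) (beta i) (y 0 i).

Definition mi_incr beta (j : 'I_d) : 'I_d -> nat :=
  fun i => (beta i + (i == j))%N.

Lemma ccontinuous_gabor_deriv K beta : ccontinuous (gabor_deriv K beta).
Proof.
apply: ccontinuousM; first exact: ccontinuous_cst.
apply: ccontinuous_prod => i.
have D := cderive_gabor1_deriv (z.1 0 i) (z.2 0 i) (beta i).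
have cy : continuous (fun y : 'rV[R]_d => y 0 i) by exact: coord_continuous.
split.
- by have := continuous_compf cy (is_derive_continuous (fun t => (D t).1)).
- by have := continuous_compf cy (is_derive_continuous (fun t => (D t).2)).
Qed.

Lemma cderive_gabor_deriv_line K beta j y :
  cderive (fun h : R => gabor_deriv K beta (h *: delta_mx 0 j + y)) 0
    (gabor_deriv K (mi_incr beta j) y).
Proof.
pose c : R[i] := K%:C * \prod_(i | i != j)
  gabor1_deriv (z.1 0 i) (z.2 0 i) (beta i) (y 0 i).
have -> : (fun h : R => gabor_deriv K beta (h *: delta_mx 0 j + y)) =
    fun h => c * gabor1_deriv (z.1 0 j) (z.2 0 j) (beta j) (h + y 0 j).
  apply/funext => h; rewrite /gabor_deriv (bigD1 j)//= mulrCA mulrC; congr (_ * _).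
    congr (_ * _); apply: eq_bigr => i ij; congr gabor1_deriv.
    by rewrite !mxE eqxx (negbTE ij) mulr0 add0r.
  by congr gabor1_deriv; rewrite !mxE !eqxx mulr1.
have D := cderive_gabor1_deriv (z.1 0 j) (z.2 0 j) (beta j) (0 + y 0 j).
apply: cderive_eq (cderive_scale c (cderive_shift D)) _; rewrite add0r.
rewrite /gabor_deriv (bigD1 j)//= /mi_incr eqxx addn1 mulrCA mulrC; congr (_ * _).
by congr (_ * _); apply: eq_bigr => i ij; rewrite (negbTE ij) addn0.
Qed.

Lemma is_derive_Re_gabor_deriv K beta j y : is_derive y (delta_mx 0 j)
  (fun y => complex.Re (gabor_deriv K beta y))
  (complex.Re (gabor_deriv K (mi_incr beta j) y)).
Proof. exact: is_derive_line (cderive_gabor_deriv_line K beta j y).1. Qed.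

Lemma is_derive_Im_gabor_deriv K beta j y : is_derive y (delta_mx 0 j)
  (fun y => complex.Im (gabor_deriv K beta y))
  (complex.Im (gabor_deriv K (mi_incr beta j) y)).
Proof. exact: is_derive_line (cderive_gabor_deriv_line K beta j y).2. Qed.

(** Links the list of directions of [partials] to a multi-index: for a tensor product only the
    multiplicities of the directions matter. *)
Definition mi_count (s : seq 'I_d) : 'I_d -> nat := fun i => count_mem i s.

Lemma mi_count_cons j s : mi_count (j :: s) = mi_incr (mi_count s) j.
Proof. by apply/funext => i; rewrite /mi_count/= addnC eq_sym. Qed.

Lemma partials_Re_gabor K s :
  partials (fun y => complex.Re (gabor_deriv K (mi_count [::]) y)) s =
  fun y => complex.Re (gabor_deriv K (mi_count s) y).
Proof.
elim: s => [//|j s IHs]; rewrite /= IHs mi_count_cons; apply/funext => y.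
by rewrite /partial; have /@derive_val := is_derive_Re_gabor_deriv K (mi_count s) j y.
Qed.

Lemma partials_Im_gabor K s :
  partials (fun y => complex.Im (gabor_deriv K (mi_count [::]) y)) s =
  fun y => complex.Im (gabor_deriv K (mi_count s) y).
Proof.
elim: s => [//|j s IHs]; rewrite /= IHs mi_count_cons; apply/funext => y.
by rewrite /partial; have /@derive_val := is_derive_Im_gabor_deriv K (mi_count s) j y.
Qed.

Lemma smooth_gabor K : smooth (gabor_deriv K (mi_count [::])).
Proof.
split=> s; rewrite ?partials_Re_gabor ?partials_Im_gabor; split.
- exact: (ccontinuous_gabor_deriv K _).1.
- by move=> i y; have /@ex_derive := is_derive_Re_gabor_deriv K (mi_count s) i y.
- exact: (ccontinuous_gabor_deriv K _).2.
- by move=> i y; have /@ex_derive := is_derive_Im_gabor_deriv K (mi_count s) i y.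
Qed.

Lemma mi_count_mi_seq (beta : multi_index d) : mi_count (mi_seq beta) = beta.
Proof.
apply/funext => i; rewrite /mi_count /mi_seq count_flatten -map_comp.
rewrite sumnE big_map big_enum/= (bigD1 i)//= count_nseq/= eqxx mul1n.
by rewrite big1 ?addn0// => j ij; rewrite count_nseq/= (negbTE ij).
Qed.

Lemma mi_partial_gabor K (beta : multi_index d) y :
  mi_partial beta (gabor_deriv K (mi_count [::])) y = gabor_deriv K beta y.
Proof.
rewrite /mi_partial partials_Re_gabor partials_Im_gabor mi_count_mi_seq.
by case: (gabor_deriv K beta y).
Qed.

(** Multiplying [gabor1_seminorm] over the coordinates bounds the square by alpha! beta! C^(2m) exp
    (2 Q / M), with Q = [normsq z]; hence the square root in the radius and the rate 1 / M. *)
Lemma gs_norm_gabor (theta M K : R) : 1 / 2 <= theta -> 3 <= M ->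
  (gs_norm theta (Num.sqrt (2 * expR 1 * M)) (gabor_deriv K (mi_count [::])) <=
   (`|K| * expR (normsq z / M))%:E)%E.
Proof.
move=> theta2 M3; set C := Num.sqrt _.
have P0 : 0 < 2 * expR 1 * M by rewrite !mulr_gt0 ?expR_gt0//; lra.
have C0 : 0 < C by rewrite sqrtr_gt0.
apply: ge_ereal_sup => _ [alpha [beta [y ->]]]; rewrite lee_fin mi_partial_gabor.
set N := (mi_fact alpha * mi_fact beta)%N; set m := (_ + _)%N.
have N0 : (0 < N)%N by rewrite muln_gt0 !prodn_gt0// => i; exact: fact_gt0.
have bound : normc ((monomial alpha y)%:C * gabor_deriv K beta y) <=
    `|K| * (Num.sqrt N%:R * C ^+ m * expR (normsq z / M)).
  have -> : normc ((monomial alpha y)%:C * gabor_deriv K beta y) =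
      `|K| * \prod_i (`|y 0 i| ^+ alpha i *
        normc (gabor1_deriv (z.1 0 i) (z.2 0 i) (beta i) (y 0 i))).
    rewrite /gabor_deriv !ComplexField.Normc.normcM !normcC normc_prod.
    rewrite big_split/= mulrCA; congr (_ * (_ * _)).
    by rewrite /monomial normr_prod; apply: eq_bigr => i _; rewrite normrX.
  rewrite ler_wpM2l// -ler_sqr ?nnegrE; last 2 first.
  - by apply: prodr_ge0 => i _; rewrite mulr_ge0 ?exprn_ge0 ?normc_ge0.
  - by rewrite !mulr_ge0 ?sqrtr_ge0 ?exprn_ge0 ?expR_ge0// ltW.
  rewrite -prodrXl.
  apply: (@le_trans _ _ (\prod_i (((alpha i)`! * (beta i)`!)%:R *
      (2 * expR 1 * M) ^+ (alpha i + beta i) *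
      expR (2 / M * ((z.1 0 i) ^+ 2 + (z.2 0 i) ^+ 2))))).
    apply: ler_prod => i _; rewrite sqr_ge0/=; exact: gabor1_seminorm.
  rewrite !exprMn sqr_sqrtr// -exprM mulnC exprM sqr_sqrtr; last exact: ltW.
  rewrite !big_split/= le_eqVlt; apply/orP; left; apply/eqP.
  congr (_ * _ * _).
  - by rewrite -natr_prod big_split.
  - by rewrite prodrXr big_split.
  - have -> : normsq z = \sum_i ((z.1 0 i) ^+ 2 + (z.2 0 i) ^+ 2).
      by rewrite /normsq /dotp -big_split; apply: eq_bigr => i _; rewrite !expr2.
    by rewrite -expR_sum -mulr_sumr -expRM_natl; congr expR; rewrite mulrA mulrAC.
(* Since theta is at least 1/2, the factor (alpha! beta!)^(- theta) pays for the square root of the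
   factorials. *)
rewrite mulrAC; apply: (@le_trans _ _ (C ^- m * normc
    ((monomial alpha y)%:C * gabor_deriv K beta y) * (Num.sqrt N%:R)^-1)).
  rewrite ler_wpM2l ?mulr_ge0 ?invr_ge0 ?exprn_ge0 ?normc_ge0//; first exact: ltW.
  rewrite -powR12_sqrt// -powRN ler_powR//; [by rewrite ler1n|lra].
rewrite ler_pdivrMr; last by rewrite sqrtr_gt0 ltr0n.
rewrite mulrC ler_pdivrMr ?exprn_gt0//; apply: (le_trans bound).
by rewrite le_eqVlt; apply/orP; left; apply/eqP; ring.
Qed.

End gabor_deriv.

(** * Growth of the STFT and geometry of phase space *)

Section stft_growth.
Context {R : realType} {d : nat}.

Lemma gabor_derivE (z : 'rV[R]_d * 'rV[R]_d) :
  gabor z = gabor_deriv z (pi `^ (- (d%:R / 4))) (mi_count [::]).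
Proof. by apply/funext => y; rewrite gaborE. Qed.

Lemma gs_space_gabor (theta : R) (z : 'rV[R]_d * 'rV[R]_d) (K : R) :
  1 / 2 <= theta -> gs_space theta (gabor_deriv z K (mi_count [::])).
Proof.
move=> theta2; exists (Num.sqrt (2 * expR 1 * 3)).
  by rewrite /= sqrtr_gt0 !mulr_gt0 ?expR_gt0.
split; first exact: smooth_gabor.
by apply: le_lt_trans (gs_norm_gabor _ _ theta2 (lexx _)) _; rewrite ltry.
Qed.

(** Continuity at 0 on a single step gives a radius [r] below which [u] is smaller than 1;
    homogeneity turns this into a bound by the step norm of the atom, which grows at rate 1 / M. *)
Lemma stft_growth (theta : R) (u : @functional R d) (eta : R) :
  1 / 2 <= theta -> gs_dual theta u -> 0 < eta ->
  exists2 A : R, 0 < A & forall z, normc (stft u z) <= A * expR (eta * normsq z).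
Proof.
move=> theta2 [lin cont] eta0.
pose Phi (z : 'rV[R]_d * 'rV[R]_d) (K : R) := gabor_deriv z K (mi_count [::]).
(* At least 3 for the norm estimate, at least 1 / eta for the rate of growth. *)
pose M := Num.max 3 eta^-1.
have M3 : 3 <= M by rewrite le_max lexx.
have M0 : 0 < M by exact: lt_le_trans M3.
have Meta : M^-1 <= eta.
  by rewrite -[leRHS]invrK lef_pV2 ?posrE ?invr_gt0// le_max lexx orbT.
pose C := Num.sqrt (2 * expR 1 * M).
have C0 : 0 < C by rewrite sqrtr_gt0 !mulr_gt0 ?expR_gt0.
pose zero : 'rV[R]_d -> R[i] := fun=> 0.
have Phi0 z : Phi z 0 = zero by apply/funext => y; rewrite /Phi /gabor_deriv mul0r.
have gs0 : gs_space theta zero by rewrite -(Phi0 0); exact: gs_space_gabor.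
have u0 : u zero = 0.
  have := lin zero zero 1 gs0 gs0.
  rewrite (_ : (fun x => _) = zero); last first.
    by apply/funext => y; rewrite /zero mulr0 addr0.
  by move/eqP; rewrite mul1r -[X in X == _]addr0 (inj_eq (addrI _)) eq_sym => /eqP.
have [V [_ _ Vstep VU]] := cont zero gs0 1 ltr01.
have [r r0 rV] := Vstep C C0.
have small z K : `|K| * expR (normsq z / M) < r -> normc (u (Phi z K)) < 1.
  move=> Kr; have : V (Phi z K).
    have le := gs_norm_gabor z K theta2 M3.
    apply: rV; last by apply: le_lt_trans le _; rewrite lte_fin.
    split; first exact: smooth_gabor.
    by apply: le_lt_trans le _; rewrite ltry.
  move=> /VU; rewrite /= u0 subr0; congr (normc (u _) < _).
  by apply/funext => y; rewrite /zero add0r.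
pose c : R := pi `^ (- (d%:R / 4)).
have c0 : 0 < c by rewrite powR_gt0 ?pi_gt0.
have scale z K : u (Phi z K) = (K / c)%:C * u (gabor z).
  have := lin _ zero (K / c)%:C (gs_space_gabor z c theta2) gs0.
  rewrite u0 addr0 -gabor_derivE => <-; congr u; apply/funext => y.
  rewrite gabor_derivE /Phi /gabor_deriv addr0 mulrA -realCM.
  by rewrite divfK// gt_eqF.
pose b : R := (2 * pi) `^ (- (d%:R / 2)).
have b0 : 0 < b by rewrite powR_gt0// mulr_gt0 ?pi_gt0.
exists (b * (2 * c / r)); first by rewrite !(mulr_gt0, divr_gt0, invr_gt0).
move=> z; rewrite /stft ComplexField.Normc.normcM normcC ger0_norm; last exact: ltW.
rewrite -mulrA ler_wpM2l//; first exact: ltW.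
pose e := expR (normsq z / M); have e0 : 0 < e by exact: expR_gt0.
apply: (@le_trans _ _ (2 * c / r * e)); last first.
  rewrite ler_wpM2l ?ler_expR//.
    by rewrite ltW// !(mulr_gt0, divr_gt0, invr_gt0).
  by rewrite mulrC ler_wpM2r// addr_ge0 ?dotp_ge0.
(* With this multiple the norm bound is r / 2, strictly below [r]. *)
pose K := r / (2 * e); have K0 : 0 < K by apply: divr_gt0 => //; exact: mulr_gt0.
have Kc0 : 0 < K / c by exact: divr_gt0.
have /small : `|K| * expR (normsq z / M) < r.
  rewrite -/e gtr0_norm// /K invfM mulrA divfK ?gt_eqF// ltr_pdivrMr//; lra.
rewrite scale ComplexField.Normc.normcM normcC (gtr0_norm Kc0) => /ltW.
rewrite -/(gabor z) mulrC -ler_pdivlMr//.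
suff -> : 1 / (K / c) = 2 * c / r * e by [].
by rewrite /K; field; rewrite !gt_eqF.
Qed.

End stft_growth.

(** * Quadratic form, weight and cones in phase space *)

Section phase_space.
Context {R : realType} {d : nat}.
Implicit Types (z w : 'rV[R]_d * 'rV[R]_d) (x y : 'rV[R]_d).

Lemma dotp_sum_sqr x : dotp x x = \sum_i x 0 i ^+ 2.
Proof. by apply: eq_bigr => i _; rewrite expr2. Qed.

Lemma dotpZ (t : R) x : dotp (t *: x) (t *: x) = t ^+ 2 * dotp x x.
Proof.
by rewrite !dotp_sum_sqr mulr_sumr; apply: eq_bigr => i _; rewrite mxE exprMn.
Qed.

Lemma dotpD_le x y : dotp (x + y) (x + y) <= 2 * dotp x x + 2 * dotp y y.
Proof.
rewrite !dotp_sum_sqr !mulr_sumr -big_split/=; apply: ler_sum => i _.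
by rewrite mxE; have := sqr_ge0 (x 0 i - y 0 i); rewrite sqrrB sqrrD; lra.
Qed.

Lemma normsq_ge0 z : 0 <= normsq z.
Proof. by rewrite addr_ge0 ?dotp_ge0. Qed.

Lemma normsqZ (t : R) z : normsq (t *: z) = t ^+ 2 * normsq z.
Proof. by rewrite /normsq !dotpZ mulrDr. Qed.

Lemma normsqB z w : normsq (z - w) = normsq (w - z).
Proof. by rewrite -opprB -scaleN1r normsqZ sqrrN expr1n mul1r. Qed.

Lemma normsqD_le z w : normsq (z + w) <= 2 * normsq z + 2 * normsq w.
Proof.
by rewrite /normsq; have := dotpD_le z.1 w.1; have := dotpD_le z.2 w.2; lra.
Qed.

Lemma continuous_normsq : continuous (@normsq R d).
Proof.
have cdot (f : 'rV[R]_d * 'rV[R]_d -> 'rV[R]_d) : continuous f ->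
    continuous (fun z => dotp (f z) (f z)).
  move=> cf; rewrite /dotp.
  have cfi i : continuous (fun z => f z 0 i).
    move=> z; exact: (@continuous_comp _ _ _ f (fun y : 'rV[R]_d => y 0 i) z
      (cf z) (@coord_continuous _ _ _ 0 i (f z))).
  elim: (index_enum _) => [|i s IHs].
    by under eq_fun do rewrite big_nil; move=> z; exact: cvg_cst.
  under eq_fun do rewrite big_cons.
  by apply: continuous_addf => //; exact: continuous_mulf.
by apply: continuous_addf; apply: cdot => z; [exact: cvg_fst|exact: cvg_snd].
Qed.

(** Passes from the sup-norm balls of the ambient topology to Euclidean ones: every coordinate is
    bounded by the Euclidean length. *)
Lemma nbhs_normsq z (A : set ('rV[R]_d * 'rV[R]_d)) : nbhs z A ->
  exists2 e : R, 0 < e & forall w, normsq (w - z) < e ^+ 2 -> A w.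
Proof.
move=> /nbhs_ballP[e /= e0 eA]; exists e => // w wz; apply: eA.
have coord (x y : 'rV[R]_d) i : dotp (y - x) (y - x) < e ^+ 2 ->
    ball (x 0 i) e (y 0 i).
  move=> xy; rewrite /ball/= distrC -ltr_sqr ?nnegrE//; last exact: ltW.
  apply: le_lt_trans xy; rewrite real_normK ?num_real// dotp_sum_sqr.
  rewrite (bigD1 i)//= !mxE lerDl; apply: sumr_ge0 => j _; exact: sqr_ge0.
have [g1 g2] := (dotp_ge0 (w - z).1, dotp_ge0 (w - z).2).
by split; split => // i j; rewrite (ord1 i); apply: coord;
  apply: le_lt_trans wz; rewrite /normsq ?lerDl ?lerDr.
Qed.

Section weight.
Variable p : R.
Hypothesis p12 : 1 < p < 2.

(** The length of x + y is at most twice the larger of the two lengths, and 2^p <= 4 because p <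
    2. *)
Lemma enorm_powR_quasi x y :
  enorm (x + y) `^ p <= 4 * (enorm x `^ p + enorm y `^ p).
Proof.
have /andP[p1 p2] := p12; have p0 : 0 <= p by lra.
pose m := Num.max (enorm x) (enorm y).
have m0 : 0 <= m by rewrite le_max sqrtr_ge0.
have xm : enorm x ^+ 2 <= m ^+ 2 by rewrite lerXn2r ?nnegrE ?sqrtr_ge0// le_max lexx.
have ym : enorm y ^+ 2 <= m ^+ 2.
  by rewrite lerXn2r ?nnegrE ?sqrtr_ge0// le_max lexx orbT.
have xym : enorm (x + y) <= 2 * m.
  rewrite -ler_sqr ?nnegrE ?sqrtr_ge0 ?mulr_ge0// exprMn.
  have := dotpD_le x y; rewrite -!enorm_sqr; lra.
apply: (le_trans (ge0_ler_powR p0 _ _ xym)); rewrite ?nnegrE ?sqrtr_ge0 ?mulr_ge0//.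
rewrite powRM//; apply: ler_pM; rewrite ?powR_ge0//.
  have -> : 4 = 2 `^ 2%:R :> R by rewrite powR_mulrn// expr2; lra.
  by rewrite ler_powR//; lra.
have : m = enorm x \/ m = enorm y.
  by rewrite /m maxEle; case: ifP => _; [right|left].
by case=> ->; [apply: ler_wpDr|apply: ler_wpDl] => //; exact: powR_ge0.
Qed.

Lemma enorm_powR_le x : enorm x `^ p <= 1 + dotp x x.
Proof.
have /andP[p1 p2] := p12; rewrite -enorm_sqr; have [x1|x1] := leP (enorm x) 1.
  apply: (@le_trans _ _ 1); last by rewrite lerDl sqr_ge0.
  have <- : 1 `^ p = 1 :> R by rewrite powR1.
  by rewrite ge0_ler_powR ?nnegrE ?sqrtr_ge0//; lra.
apply: (@le_trans _ _ (enorm x ^+ 2)); last by rewrite lerDr.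
rewrite -powR_mulrn ?sqrtr_ge0// ler_powR//; [exact: ltW|lra].
Qed.

End weight.

Lemma invf_between12 (theta : R) : 1 / 2 < theta < 1 -> 1 < theta^-1 < 2.
Proof.
move=> /andP[t1 t2]; have t0 : 0 < theta by lra.
rewrite invf_gt1// t2 /= -[X in _ < X]invrK ltf_pV2 ?posrE ?invr_gt0//.
by rewrite -div1r.
Qed.

Lemma phase_weight_quasi (theta : R) z w : 1 / 2 < theta < 1 ->
  phase_weight theta (z + w) <= 4 * (phase_weight theta z + phase_weight theta w).
Proof.
move=> theta12; rewrite /phase_weight.
have p12 := invf_between12 theta12.
apply: (le_trans (lerD (enorm_powR_quasi p12 z.1 w.1)
  (enorm_powR_quasi p12 z.2 w.2))).
by rewrite -mulrDr addrACA.
Qed.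

Lemma phase_weight_le (theta : R) z : 1 / 2 < theta < 1 ->
  phase_weight theta z <= 2 + normsq z.
Proof.
move=> theta12; rewrite /phase_weight /normsq.
have p12 := invf_between12 theta12.
apply: (le_trans (lerD (enorm_powR_le p12 z.1) (enorm_powR_le p12 z.2))).
by move: (dotp z.1 z.1) (dotp z.2 z.2) => a b; lra.
Qed.

(** By homogeneity [z] may be rescaled close to [z0]; the rescaled [w] then stays at a definite
    distance from it, while the rescaled [z] stays bounded. *)
Lemma conic_separation (Gamma : set ('rV[R]_d * 'rV[R]_d)) z0 :
  open Gamma -> conic Gamma -> Gamma z0 ->
  exists Gamma' : set ('rV[R]_d * 'rV[R]_d), exists2 L : R, 0 < L &
  [/\ open Gamma', conic Gamma', Gamma' z0 & forall z w, Gamma' z -> ~ Gamma w ->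
      normsq z <= L * normsq (z - w) /\ normsq w <= L * normsq (z - w)].
Proof.
move=> oG [G0 cG] Gz0.
have [e e0 eG] := nbhs_normsq (oG _ Gz0).
have e20 : 0 < e ^+ 2 by rewrite exprn_gt0.
pose B := 2 * normsq z0 + e ^+ 2 / 2.
have B0 : 0 < B by have := normsq_ge0 z0; rewrite /B; lra.
pose L1 := 4 * B / e ^+ 2.
have L10 : 0 < L1 by rewrite divr_gt0// mulr_gt0//.
(* The cone over the ball of radius e / 2 about [z0]; the ball of radius [e] lies in [Gamma]. *)
exists [set z | exists2 t : R, 0 < t & normsq (t *: z - z0) < e ^+ 2 / 4].
(* [L1] bounds the ratio of [normsq z] to [normsq (z - w)]; the bound for [w] follows from w = z +
   (w - z). *)
exists (2 * L1 + 2); first lra.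
split.
- rewrite (_ : [set z | _] = \bigcup_(t in [set t : R | 0 < t])
      ((fun z => normsq (t *: z - z0)) @^-1` [set s | s < e ^+ 2 / 4])); last first.
    by apply/seteqP; split=> z /= [t t0 tz]; exists t.
  apply: bigcup_open => t _; apply: open_comp; last exact: open_lt.
  move=> z _; have ct : {for z, continuous (fun z => t *: z - z0)}.
    by apply: cvgB; [exact: scaler_continuous|exact: cvg_cst].
  exact: (@continuous_comp _ _ _ (fun z => t *: z - z0) (@normsq R d) z ct
    (@continuous_normsq _)).
- split.
    move=> z [t t0 tz]; apply/eqP => z00; have : Gamma 0 by
      apply: eG; move: tz; rewrite z00 scaler0 sub0r; lra.
    by move=> /G0; rewrite /= eqxx.
  move=> s z s0 [t t0 tz]; exists (t / s); first exact: divr_gt0.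
  by rewrite scalerA divfK// gt_eqF.
- exists 1 => //; rewrite scale1r subrr -(scale0r (0 : 'rV[R]_d * 'rV[R]_d)).
  by rewrite normsqZ expr0n mul0r divr_gt0.
move=> z w [t t0 tz] nGw.
have nGtw : ~ Gamma (t *: w).
  by move=> /(cG t^-1 _); rewrite scalerA mulVf ?gt_eqF// scale1r invr_gt0 => /(_ t0).
have far : e ^+ 2 <= normsq (t *: w - z0).
  by rewrite leNgt; apply/negP => /eG.
have t20 : 0 < t ^+ 2 by rewrite exprn_gt0.
have sep : e ^+ 2 / 4 <= t ^+ 2 * normsq (z - w).
  have := normsqD_le (t *: w - t *: z) (t *: z - z0).
  rewrite addrA subrK -scalerBr normsqZ (normsqB w z); lra.
have tz1 : t ^+ 2 * normsq z <= B.
  have := normsqD_le (t *: z - z0) z0; rewrite subrK normsqZ /B; lra.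
have zL : normsq z <= L1 * normsq (z - w).
  rewrite -(ler_pM2l t20); apply: (le_trans tz1).
  have -> : B = L1 * (e ^+ 2 / 4) by rewrite /L1; field; rewrite gt_eqF.
  by rewrite [leRHS]mulrCA ler_pM2l.
have := normsqD_le z (w - z); rewrite addrC subrK (normsqB w z).
have := normsq_ge0 (z - w); nra.
Qed.

End phase_space.

(** * The localization operator *)

Section gauss_phase.
Context {R : realType} {d : nat}.

(** The rate 1/8 is half of the rate 1/4 of [stft_gabor] and corresponds to standard deviation 2.
    The mass of a normal density does not depend on its mean, so [kappa] is uniform in [x]. *)
Lemma Rintegral_gauss_rV : exists2 kappa : R, 0 < kappa & forall x : 'rV[R]_d,
  (lebesgue_rV d).-integrable setT
    (fun y => (expR (- (dotp (x - y) (x - y) / 8)))%:E) /\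
  \int[lebesgue_rV d]_y expR (- (dotp (x - y) (x - y) / 8)) = kappa.
Proof.
have s0 : (2 : R) != 0 by [].
exists ((normal_peak (2 : R))^-1 ^+ d) => [|x].
  by rewrite exprn_gt0// invr_gt0 normal_peak_gt0.
pose f i t : R[i] := (normal_fun (x 0 i) 2 t)%:C.
have fE t m : normal_fun m 2 t = (normal_peak 2)^-1 * normal_pdf m 2 t :> R.
  by rewrite normal_pdfE// mulKf// gt_eqF// normal_peak_gt0.
have if1 (m : R) : (@lebesgue_measure R).-integrable setT (EFin \o normal_fun m 2).
  rewrite (_ : EFin \o _ = fun t => ((normal_peak (2 : R))^-1)%:E *
      (normal_pdf m 2 t)%:E)%E; last first.
    by apply/funext => t /=; rewrite fE EFinM.
  by apply: integrableZl => //; exact: integrable_normal_pdf.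
have If1 (m : R) : \int[@lebesgue_measure R]_t normal_fun m 2 t = (normal_peak 2)^-1.
  under eq_Rintegral do rewrite fE.
  rewrite RintegralZl//; last exact: integrable_normal_pdf.
  by rewrite [X in _ * X](_ : _ = 1) ?mulr1// /Rintegral integral_normal_pdf.
have [iF eF] := cintegral_prod_rV (fun i => cintegrable_real (if1 (x 0 i))).
have E : (fun y : 'rV[R]_d => \prod_i (normal_fun (x 0 i) 2 (y 0 i))%:C) =
    fun y => (expR (- (dotp (x - y) (x - y) / 8)))%:C.
  apply/funext => y; rewrite -realC_prod /normal_fun -expR_sum.
  congr (expR _)%:C.
  rewrite dotp_sum_sqr mulr_suml -sumrN; apply: eq_bigr => i _.
  have -> : (2 : R) ^+ 2 *+ 2 = 8 by rewrite expr2 mulr2n; lra.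
  by rewrite !mxE mulNr -sqrrN opprB.
rewrite E in iF eF; split; first exact: iF.1.
move: eF; rewrite cintegral_real.
under eq_bigr do rewrite cintegral_real If1.
by rewrite -realC_prod prodr_const card_ord => -[].
Qed.

Lemma Rintegral_gauss_phase : exists2 kappa : R, 0 < kappa &
  forall z1 : 'rV[R]_d * 'rV[R]_d,
  (@lebesgue_phase R d).-integrable setT
    (fun z => (expR (- (normsq (z1 - z) / 8)))%:E) /\
  \int[@lebesgue_phase R d]_z expR (- (normsq (z1 - z) / 8)) = kappa.
Proof.
have [k k0 H] := Rintegral_gauss_rV; exists (k * k) => [|z1]; first exact: mulr_gt0.
have [[i1 e1] [i2 e2]] := (H z1.1, H z1.2).
have E z : expR (- (normsq (z1 - z) / 8)) =
    expR (- (dotp (z1.1 - z.1) (z1.1 - z.1) / 8)) *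
    expR (- (dotp (z1.2 - z.2) (z1.2 - z.2) / 8)) :> R.
  by rewrite -expRD; congr expR; rewrite -opprD -mulrDl.
split.
- have := integrable_tensor i1 i2; apply: eq_integrable => // z _.
  by rewrite E.
- under eq_Rintegral do rewrite E.
  by rewrite (Rintegral_tensor i1 i2) e1 e2.
Qed.

End gauss_phase.

(** * Pointwise bound on the integrand of the localization operator *)

Section integrand_bound.
Context {R : realType} {d : nat}.
Implicit Types z : 'rV[R]_d * 'rV[R]_d.

Lemma phase_weight_ge0 (theta : R) z : 0 <= phase_weight theta z.
Proof. by rewrite addr_ge0 ?powR_ge0. Qed.

Lemma localization_integrand_bound (theta e L Ca C A ea : R)
    (Gamma : set ('rV[R]_d * 'rV[R]_d))
    (a V : 'rV[R]_d * 'rV[R]_d -> R) z1 z :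
  1 / 2 < theta < 1 -> 0 < e -> e <= 1 / 4 -> 0 < L -> 0 < Ca -> 0 < C -> 0 < A ->
  0 < ea -> ea <= e / 2 -> ea <= 1 / (32 * L) ->
  (Gamma z -> V z <= C * expR (- e * phase_weight theta z)) ->
  V z <= A * expR (1 / (32 * L) * normsq z) ->
  (~ Gamma z -> normsq z1 <= L * normsq (z1 - z) /\ normsq z <= L * normsq (z1 - z)) ->
  0 <= a z -> 0 <= V z ->
  a z <= Ca * expR (ea * phase_weight theta z) ->
  a z * V z * expR (- (normsq (z1 - z) / 4)) <=
  Ca * (C * expR e + A * expR (1 / (4 * L))) *
    expR (- Num.min (e / 8) (1 / (16 * L)) * phase_weight theta z1) *
    expR (- (normsq (z1 - z) / 8)).
Proof.
move=> th e0 e4 L0 Ca0 C0 A0 ea0 eae eaL VG VA sep a0 V0 aCa.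
have w0 := phase_weight_ge0 theta z.
have w10 := phase_weight_ge0 theta z1.
have w1le := phase_weight_le z1 th.
have wle := phase_weight_le z th.
have dle := phase_weight_le (z1 - z) th.
have quasi := phase_weight_quasi z (z1 - z) th.
rewrite addrC subrK in quasi.
have D0 := normsq_ge0 (z1 - z); have Q0 := normsq_ge0 z; have Q10 := normsq_ge0 z1.
set e2 := Num.min _ _.
have e2e : e2 <= e / 8 by rewrite ge_min lexx.
have e2L : e2 <= 1 / (16 * L) by rewrite ge_min lexx orbT.
move: (phase_weight theta z) (phase_weight theta z1)
  (phase_weight theta (z1 - z)) (normsq (z1 - z)) (normsq z) (normsq z1) (a z) (V z)
  w0 w10 w1le wle dle quasi D0 Q0 Q10 VG VA sep a0 V0 aCa.
move=> w w1 wd D Q Q1 az Vz w0 w10 w1le wle dle quasi D0 Q0 Q10 VG VA sep a0 V0 aCa.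
set T := expR (- e2 * w1) * expR (- (D / 8)).
have T0 : 0 <= T by rewrite mulr_ge0 ?expR_ge0.
have X0 : 0 <= Ca * (C * expR e) by rewrite !mulr_ge0 ?expR_ge0 ?ltW.
have Y0 : 0 <= Ca * (A * expR (1 / (4 * L))) by rewrite !mulr_ge0 ?expR_ge0 ?ltW.
(* Each region contributes one of the two nonnegative terms of the constant. *)
suff : az * Vz * expR (- (D / 4)) <= Ca * (C * expR e) * T \/
       az * Vz * expR (- (D / 4)) <= Ca * (A * expR (1 / (4 * L))) * T.
  have -> : Ca * (C * expR e + A * expR (1 / (4 * L))) * expR (- e2 * w1) *
      expR (- (D / 8)) =
      Ca * (C * expR e) * T + Ca * (A * expR (1 / (4 * L))) * T by rewrite /T; ring.
  by case=> /le_trans; apply; [rewrite lerDl|rewrite lerDr]; exact: mulr_ge0.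
have [GZ|nGZ] := pselect (Gamma z).
(* On the cone, half of the decay in [w] survives [a]. Then (e / 8) w1 <= (e / 2) (w + wd) <= (e /
   2) w + e + (e / 2) D, and (e / 2) D <= D / 8 as e <= 1/4. *)
- left.
  apply: (@le_trans _ _ ((Ca * expR (ea * w)) * (C * expR (- e * w)) *
      expR (- (D / 4)))).
    by rewrite ler_wpM2r ?expR_ge0// ler_pM// VG.
  have -> : Ca * expR (ea * w) * (C * expR (- e * w)) * expR (- (D / 4)) =
      Ca * C * expR (ea * w + - e * w + - (D / 4)) by rewrite !expRD; ring.
  have -> : Ca * (C * expR e) * T = Ca * C * expR (e + - e2 * w1 + - (D / 8)).
    by rewrite /T !expRD; ring.
  apply: ler_wpM2l; first by apply: mulr_ge0; exact: ltW.
  rewrite ler_expR.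
  have h1 : ea * w <= e / 2 * w by rewrite ler_wpM2r.
  have h2 : e2 * w1 <= e / 8 * w1 by rewrite ler_wpM2r.
  have h3 : e * w1 <= e * (4 * (w + wd)) by rewrite ler_wpM2l// ltW.
  have h4 : e * wd <= e * (2 + D) by rewrite ler_wpM2l// ltW.
  have h5 : e * D <= 1 / 4 * D by rewrite ler_wpM2r.
  lra.
(* Off the cone, [Q] and [Q1] are at most L D. The growth of [a], that of [V] and the wanted decay
   cost D/32, D/32 and D/16, in all D/8, plus constants 3 / (16 L) <= 1 / (4 L). *)
- right; have [Q1D QD] := sep nGZ.
  apply: (@le_trans _ _ ((Ca * expR (ea * w)) * (A * expR (1 / (32 * L) * Q)) *
      expR (- (D / 4)))).
    by rewrite ler_wpM2r ?expR_ge0// ler_pM.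
  have -> : Ca * expR (ea * w) * (A * expR (1 / (32 * L) * Q)) * expR (- (D / 4)) =
      Ca * A * expR (ea * w + 1 / (32 * L) * Q + - (D / 4)) by rewrite !expRD; ring.
  have -> : Ca * (A * expR (1 / (4 * L))) * T =
      Ca * A * expR (1 / (4 * L) + - e2 * w1 + - (D / 8)).
    by rewrite /T !expRD; ring.
  apply: ler_wpM2l; first by apply: mulr_ge0; exact: ltW.
  rewrite ler_expR.
  pose l := L^-1; have l0 : 0 < l by rewrite invr_gt0.
  have l32 : 1 / (32 * L) = l / 32 by rewrite /l; field; rewrite gt_eqF.
  have l16 : 1 / (16 * L) = l / 16 by rewrite /l; field; rewrite gt_eqF.
  have l4 : 1 / (4 * L) = l / 4 by rewrite /l; field; rewrite gt_eqF.
  rewrite l32 l4; rewrite l32 in eaL; rewrite l16 in e2L.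
  have lQ : l * Q <= D by rewrite /l ler_pdivrMl.
  have lQ1 : l * Q1 <= D by rewrite /l ler_pdivrMl.
  have h1 : ea * w <= l / 32 * w by rewrite ler_wpM2r.
  have h2 : e2 * w1 <= l / 16 * w1 by rewrite ler_wpM2r.
  have h3 : l * w <= l * (2 + Q) by rewrite ler_wpM2l// ltW.
  have h4 : l * w1 <= l * (2 + Q1) by rewrite ler_wpM2l// ltW.
  lra.
Qed.

End integrand_bound.

Local Close Scope complex_scope.
Unset Implicit Arguments.

Theorem proposition4p3 (R : realType) (d : nat) (theta : R)
    (htheta : 1 / 2 < theta < 1)
    (a : 'rV[R]_d * 'rV[R]_d -> R[i])
    (ha : Linfty_loc a)
    (hgrowth : forall e : R, 0 < e -> exists2 Ce : R, 0 < Ce &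
      {ae (@lebesgue_phase R d), forall z,
        normc (a z) <= Ce * expR (e * phase_weight theta z)})
    (u : @functional R d) (hu : gs_dual theta u) :
  gs_wavefront theta (localization_op a u) `<=` gs_wavefront theta u.
Proof.
move=> z0 [z00 notAu]; split => // -[Gamma [oG cG Gz0 [C [e1 [C0 e10 uG]]]]].
apply: notAu.
have [Gamma' [L L0 [oG' cG' Gz0' sep]]] := conic_separation oG cG Gz0.
exists Gamma'; split => //.
(* Capping the decay rate at 1/4 lets half of the Gaussian pay for moving the decay from [z] to
   [z1]. *)
pose e := Num.min e1 (1 / 4).
have e0 : 0 < e by rewrite lt_min e10 divr_gt0.
have e4 : e <= 1 / 4 by rewrite ge_min lexx orbT.
have uGe z : Gamma z -> normc (stft u z) <= C * expR (- e * phase_weight theta z).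
  move=> /uG /le_trans; apply; rewrite ler_wpM2l ?(ltW C0)// ler_expR.
  by rewrite !mulNr lerN2 ler_wpM2r ?phase_weight_ge0// ge_min lexx.
have l0 : 0 < 1 / (32 * L) by rewrite divr_gt0// mulr_gt0.
have theta2 : 1 / 2 <= theta by case/andP: htheta => /ltW.
have [A A0 uA] := stft_growth theta2 hu l0.
(* The growth of [a] must cost at most half of the decay on [Gamma] and a small part of the Gaussian
   off it. *)
pose ea := Num.min (e / 2) (1 / (32 * L)).
have ea0 : 0 < ea by rewrite lt_min l0 divr_gt0.
have eae : ea <= e / 2 by rewrite ge_min lexx.
have eaL : ea <= 1 / (32 * L) by rewrite ge_min lexx orbT.
have [Ca Ca0 aCa] := hgrowth ea ea0.
have [kappa kappa0 Hkappa] := @Rintegral_gauss_phase R d.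
pose b : R := (2 * pi) `^ (- (d%:R / 2)).
have b0 : 0 < b by rewrite powR_gt0// mulr_gt0 ?pi_gt0.
pose K := Ca * (C * expR e + A * expR (1 / (4 * L))).
have K0 : 0 < K by rewrite mulr_gt0// addr_gt0// mulr_gt0 ?expR_gt0.
pose e2 := Num.min (e / 8) (1 / (16 * L)).
(* One factor [b] normalizes the STFT at [z1], the other comes from [stft_gabor]; 2 is the loss in
   [normc_cintegral_le], and [kappa] the mass of the remaining Gaussian. *)
exists (b * (2 * (b * K * kappa))), e2; split.
- by do 4![apply: mulr_gt0 => //].
- by rewrite lt_min; apply/andP; split; apply: divr_gt0 => //; exact: mulr_gt0.
move=> z1 Gz1; have [iD ID] := Hkappa z1.
pose g z := b * (K * expR (- e2 * phase_weight theta z1)) *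
  expR (- (normsq (z1 - z) / 8)).
have c0 : 0 <= b * (K * expR (- e2 * phase_weight theta z1)).
  by do 2![apply: mulr_ge0; first exact: ltW]; exact: expR_ge0.
have g0 z : 0 <= g z by rewrite mulr_ge0// expR_ge0.
have ig : (@lebesgue_phase R d).-integrable setT (EFin \o g).
  have := integrableZl measurableT (b * (K * expR (- e2 * phase_weight theta z1))) iD.
  by apply: eq_integrable => // z _; rewrite /g EFinM.
have Ig : \int[@lebesgue_phase R d]_z g z =
    b * (K * expR (- e2 * phase_weight theta z1)) * kappa.
  by rewrite RintegralZl// ID.
(* Up to [b], the STFT at [z1] is the localization integral tested on [gabor z1]. *)
rewrite [stft (localization_op a u) z1]/stft -/(gabor z1).
rewrite ComplexField.Normc.normcM normcC ger0_norm; last exact: ltW.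
rewrite -/b -[leRHS]mulrA ler_wpM2l//; first exact: ltW.
have -> : 2 * (b * K * kappa) * expR (- e2 * phase_weight theta z1) =
    2 * \int[@lebesgue_phase R d]_z g z by rewrite Ig; ring.
apply: normc_cintegral_le => //.
apply: filterS aCa => z aCaz.
rewrite 2!ComplexField.Normc.normcM normc_conjc stft_gabor -/b /g.
have := @localization_integrand_bound R d theta e L Ca C A ea Gamma (fun z => normc (a z))
  (fun z => normc (stft u z)) z1 z htheta e0 e4 L0 Ca0 C0 A0 ea0 eae eaL (uGe z) (uA z)
  (sep z1 z Gz1) (normc_ge0 _) (normc_ge0 _) aCaz.
rewrite -/K -/e2 => H.
rewrite mulrCA -[leRHS]mulrA; apply: ler_wpM2l; first exact: ltW.
exact: H.
Qed.
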